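(* Let $\alpha,\beta\in\mathbb{N}_0^3$. Then the recursive algorithm $\mathtt{ComputeI}$ (defined in the context), called with input $(\alpha,\beta)$, terminates and returns $$\mathcal{I}(\alpha,\beta)=\frac{1}{|T|}\int_T \frac{\lambda_0^{\alpha_0}\lambda_1^{\alpha_1}\lambda_2^{\alpha_2}}{(1-\lambda_0)^{\beta_0}(1-\lambda_1)^{\beta_1}(1-\lambda_2)^{\beta_2}}\,\mathrm{d}x\in[0,\infty],$$ where $T$ is a triangle with barycentric coordinates $\lambda_0,\lambda_1,\lambda_2$.
   Context: Let $T\subset\mathbb{R}^2$ be a (non-degenerate) triangle with vertices $v_0,v_1,v_2$ and barycentric coordinates $\lambda_0,\lambda_1,\lambda_2$ (affine functions with $\lambda_j(v_k)=\delta_{jk}$, so $\lambda_0+\lambda_1+\lambda_2=1$). $|T|$ is its area. For $\alpha=(\alpha_0,\alpha_1,\alpha_2)$, $\beta=(\beta_0,\beta_1,\beta_2)\in\mathbb{N}_0^3$, the value $\mathcal{I}(\alpha,\beta)\in[0,\infty]$ displayed in the claim is independent of the choice of $T$ (by affine transformation). Write $|\alpha|=\alpha_0+\alpha_1+\alpha_2$ and $\hat v_0=(1,0,0)$, $\hat v_1=(0,1,0)$, $\hat v_2=(0,0,1)$. Empty sums are $0$. Algorithm $\mathtt{ComputeJ}(\alpha_1,\alpha_2,\beta_1,\beta_2)$, input $\alpha_1,\alpha_2,\beta_1,\beta_2\in\mathbb{N}_0$. The steps are executed in order; a ''return'' ends the call. 1. If $\max\{\alpha_1+\beta_1,\alpha_2+\beta_2\}>\alpha_1+\alpha_2+1$,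 return $\infty$. 2. Sort (simultaneously permute) the pairs $(\alpha_j,\beta_j)_{j=1,2}$ such that $\beta_2\ge\beta_1$. 3. If $\beta_1=0$, return $\frac{2}{\alpha_1+1}\,\frac{\alpha_2!\,(\alpha_1-\beta_2+1)!}{(\alpha_1+\alpha_2-\beta_2+2)!}$. 4. If $\beta_1=1$ and $\beta_2=1$, return $-2\sum_{i=1}^{\alpha_2}\frac1{i^2}+\frac{\pi^2}{3}-2\sum_{j=1}^{\alpha_1}\frac1j\,\frac{\alpha_2!\,(j-1)!}{(\alpha_2+j)!}$. 5. If $\beta_1=1$ and $\beta_2>1$, return $\frac{\beta_2-\alpha_2-2}{\beta_2-1}\,\mathtt{ComputeJ}(\alpha_1,\alpha_2,1,\beta_2-1)+\frac{2}{\beta_2-1}\,\frac{(\alpha_1-\beta_2+1)!\,\alpha_2!}{(\alpha_1-\beta_2+\alpha_2+2)!}$. 6. Otherwise ($\beta_1>1$), return $\frac{\beta_1-\alpha_1-2}{\beta_1-1}\,\mathtt{ComputeJ}(\alpha_1,\alpha_2,\beta_1-1,\beta_2)+\frac{2}{\beta_1-1}\,\frac{(\alpha_2-\beta_1+1)!\,(\alpha_1-\beta_2+1)!}{(\alpha_2-\beta_1+\alpha_1-\beta_2+3)!}$. Algorithm $\mathtt{ComputeI}(\alpha,\beta)$, input $\alpha,\beta\in\mathbb{N}_0^3$. The steps are executed in order; a ''return'' ends the call. 1. If $\max\{\alpha_0+\beta_0,\alpha_1+\beta_1,\alpha_2+\beta_2\}>|\alpha|+1$, return $\infty$. 2. Sort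 (simultaneously permute) the pairs $(\alpha_j,\beta_j)_{j=0,1,2}$ such that $\beta_0\le\beta_1\le\beta_2$. 3. If $\beta_0=\beta_1=0$, return $2\,\frac{\alpha_0!\,\alpha_1!\,\alpha_2!}{(|\alpha|-\beta_2+2)!}\,\frac{(\alpha_0+\alpha_1+1-\beta_2)!}{(\alpha_0+\alpha_1+1)!}$. 4. If $\beta_0\ge1$, return $\frac12\sum_{j=0}^2\mathtt{ComputeI}(\alpha,\beta-\hat v_j)$. 5. If $\alpha_0=0$, return $\mathtt{ComputeJ}(\alpha_1,\alpha_2,\beta_1,\beta_2)$. 6. If $\alpha_1+\beta_1<|\alpha|+1$, return $\mathtt{ComputeI}(\alpha-\hat v_0,\beta-\hat v_2)-\mathtt{ComputeI}(\alpha-\hat v_0+\hat v_1,\beta)$. 7. If $\alpha_2+\beta_2<|\alpha|+1$, return $\mathtt{ComputeI}(\alpha-\hat v_0,\beta-\hat v_1)-\mathtt{ComputeI}(\alpha-\hat v_0+\hat v_2,\beta)$. 8. Otherwise, return $\frac12\sum_{j=1}^2\big(\mathtt{ComputeI}(\alpha,\beta-\hat v_j)+\mathtt{ComputeI}(\alpha-\hat v_0+\hat v_j,\beta-\hat v_j)\big)-\mathtt{ComputeI}(\alpha-\hat v_0+\hat v_1+\hat v_2,\beta)$. *)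

(* Defs.v *)
From HB Require Import structures.
From mathcomp Require Import all_boot all_order all_algebra.
From mathcomp Require Import all_classical all_reals all_analysis.

Set Implicit Arguments.
Unset Strict Implicit.
Unset Printing Implicit Defensive.
Import Order.TTheory GRing.Theory Num.Theory.
Local Open Scope ring_scope.

(** * Triangles in the plane *)

Notation i0 := (@Ordinal 3 0 isT).
Notation i1 := (@Ordinal 3 1 isT).
Notation i2 := (@Ordinal 3 2 isT).

Section Triangle.
Variable R : realType.
Implicit Types (v : 'I_3 -> R * R) (lam : 'I_3 -> R * R -> R).

Definition noncollinear v : Prop :=
  ((v i1).1 - (v i0).1) * ((v i2).2 - (v i0).2)
  - ((v i2).1 - (v i0).1) * ((v i1).2 - (v i0).2) != 0.

Definition triangle v : set (R * R) :=
  [set x | exists t : 'I_3 -> R,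
    [/\ forall j, 0 <= t j, \sum_j t j = 1 &
        x = (\sum_j t j * (v j).1, \sum_j t j * (v j).2)]].

Definition affine (f : R * R -> R) : Prop :=
  exists a b c : R, forall x, f x = a * x.1 + b * x.2 + c.

Definition barycentric v lam : Prop :=
  (forall j, affine (lam j)) /\ (forall j k, lam j (v k) = (j == k)%:R).

(* The product type is annotated with [measurableTypeR] to fix the Borel sigma-
   algebra of each factor; it is convertible to R * R. *)
Definition lebesgue2 : set (measurableTypeR R * measurableTypeR R) -> \bar R :=
  (@lebesgue_measure R \x @lebesgue_measure R)%E.
HB.instance Definition _ := Measure.on lebesgue2.

(* Division by zero gives 0; the denominator only vanishes at vertices of the
   triangle, a null set, so this does not affect the integral below. *)
Definition integrand lam (alpha beta : {ffun 'I_3 -> nat}) (x : R * R) : R :=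
  (\prod_j lam j x ^+ alpha j) / (\prod_j (1 - lam j x) ^+ beta j).

(* The inverse of the area is taken in \bar R; when the vertices are not
   collinear, the area is finite and positive. *)
Definition Ival v lam (alpha beta : {ffun 'I_3 -> nat}) : \bar R :=
  ((lebesgue2 (triangle v))^-1 *
   \int[lebesgue2]_(x in triangle v) (integrand lam alpha beta x)%:E)%E.

End Triangle.

(** * Programs with recursive calls and sorting *)

(* [CallI alpha beta k] calls ComputeI on (alpha, beta) and continues as [k r],
   where r is the value returned by the call; similarly for [CallJ].
   [Sort s k] sorts the list of pairs s with respect to the second components
   and continues with the sorted list. How ties are broken is left open. *)
Inductive prog (R : realType) : Type :=
| Ret of \bar R
| CallI of {ffun 'I_3 -> nat} & {ffun 'I_3 -> nat} & (\bar R -> prog R)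
| CallJ of nat & nat & nat & nat & (\bar R -> prog R)
| Sort n of n.-tuple (nat * nat) & (n.-tuple (nat * nat) -> prog R).

Arguments Ret {R}.
Arguments CallI {R}.
Arguments CallJ {R}.
Arguments Sort {R n}.

Definition addhat (a : {ffun 'I_3 -> nat}) (j : 'I_3) : {ffun 'I_3 -> nat} :=
  [ffun i => (a i + (i == j))%N].
Definition subhat (a : {ffun 'I_3 -> nat}) (j : 'I_3) : {ffun 'I_3 -> nat} :=
  [ffun i => (a i - (i == j))%N].

Notation "a ':+' j" := (addhat a j) (at level 50, left associativity).
Notation "a ':-' j" := (subhat a j) (at level 50, left associativity).

Section Algorithms.
Variable R : realType.

(* In the factorials, additions are performed before the (truncated)
   subtractions: e.g. (a1 + 1 - b2)`! has to be 0`! when b2 = a1 + 1. Past the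
   test for +oo no subtraction is truncated. *)

Definition ComputeJ (a1 a2 b1 b2 : nat) : prog R :=
  if (maxn (a1 + b1) (a2 + b2) > a1 + a2 + 1)%N then Ret +oo%E else
  Sort [tuple (a1, b1); (a2, b2)] (fun s =>
  let: (a1, b1) := tnth s ord0 in
  let: (a2, b2) := tnth s ord_max in
  if b1 == 0%N then
    Ret (2 / (a1 + 1)%:R *
         ((a2`! * (a1 + 1 - b2)`!)%:R / (a1 + a2 + 2 - b2)`!%:R))%:E
  else if (b1 == 1%N) && (b2 == 1%N) then
    Ret (- 2 * (\sum_(1 <= i < a2.+1) 1 / i%:R ^+ 2) + pi ^+ 2 / 3
         - 2 * (\sum_(1 <= j < a1.+1)
                  1 / j%:R * ((a2`! * (j - 1)`!)%:R / (a2 + j)`!%:R)))%:E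
  else if (b1 == 1%N) && (b2 > 1)%N then
    CallJ a1 a2 1 (b2 - 1) (fun r =>
    Ret (((b2%:R - a2%:R - 2) / (b2%:R - 1))%:E * r +
         (2 / (b2%:R - 1) *
          (((a1 + 1 - b2)`! * a2`!)%:R / (a1 + a2 + 2 - b2)`!%:R))%:E)%E)
  else
    CallJ a1 a2 (b1 - 1) b2 (fun r =>
    Ret (((b1%:R - a1%:R - 2) / (b1%:R - 1))%:E * r +
         (2 / (b1%:R - 1) *
          (((a2 + 1 - b1)`! * (a1 + 1 - b2)`!)%:R /
           (a2 + a1 + 3 - b1 - b2)`!%:R))%:E)%E)).

Definition ComputeI (alpha beta : {ffun 'I_3 -> nat}) : prog R :=
  let sz := (\sum_j alpha j)%N in
  if (\max_j (alpha j + beta j) > sz + 1)%N then Ret +oo%E else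
  Sort [tuple (alpha j, beta j) | j < 3] (fun s =>
  let a : {ffun 'I_3 -> nat} := [ffun j => (tnth s j).1] in
  let b : {ffun 'I_3 -> nat} := [ffun j => (tnth s j).2] in
  if (b i0 == 0%N) && (b i1 == 0%N) then
    Ret (2 * (((a i0)`! * (a i1)`! * (a i2)`!)%:R / (sz + 2 - b i2)`!%:R) *
         ((a i0 + a i1 + 1 - b i2)`!%:R / (a i0 + a i1 + 1)`!%:R))%:E
  else if (b i0 >= 1)%N then
    CallI a (b :- i0) (fun r0 =>
    CallI a (b :- i1) (fun r1 =>
    CallI a (b :- i2) (fun r2 =>
    Ret ((1 / 2)%:E * (r0 + r1 + r2))%E)))
  else if a i0 == 0%N then
    CallJ (a i1) (a i2) (b i1) (b i2) Ret
  else if (a i1 + b i1 < sz + 1)%N then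
    CallI (a :- i0) (b :- i2) (fun r =>
    CallI (a :- i0 :+ i1) b (fun r' =>
    Ret (r - r')%E))
  else if (a i2 + b i2 < sz + 1)%N then
    CallI (a :- i0) (b :- i1) (fun r =>
    CallI (a :- i0 :+ i2) b (fun r' =>
    Ret (r - r')%E))
  else
    CallI a (b :- i1) (fun r1 =>
    CallI (a :- i0 :+ i1) (b :- i1) (fun r1' =>
    CallI a (b :- i2) (fun r2 =>
    CallI (a :- i0 :+ i2) (b :- i2) (fun r2' =>
    CallI (a :- i0 :+ i1 :+ i2) b (fun r =>
    Ret ((1 / 2)%:E * ((r1 + r1') + (r2 + r2')) - r)%E)))))).

(* [returns p r]: however ties are broken when sorting, the execution of p
   terminates and returns r. Being inductive, it only holds of terminating
   executions. *)
Inductive returns : prog R -> \bar R -> Prop :=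
| returns_Ret r : returns (Ret r) r
| returns_CallI alpha beta k u r :
    returns (ComputeI alpha beta) u -> returns (k u) r ->
    returns (CallI alpha beta k) r
| returns_CallJ a1 a2 b1 b2 k u r :
    returns (ComputeJ a1 a2 b1 b2) u -> returns (k u) r ->
    returns (CallJ a1 a2 b1 b2 k) r
| returns_Sort n (s : n.-tuple (nat * nat)) k r :
    (forall t : n.-tuple (nat * nat),
       perm_eq t s -> sorted (fun p q => (p.2 <= q.2)%N) t ->
       returns (k t) r) ->
    returns (Sort s k) r.

End Algorithms.

(* Main.v *)
Require Import Defs.
From mathcomp Require Import all_boot all_order all_algebra fingroup perm.
From mathcomp Require Import all_classical all_reals all_analysis
  measurable_realfun.
From mathcomp Require Import ring lra zify.

(** The moments I(alpha, beta) do not depend on the triangle, by an affine change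
    of variables (two applications of Tonelli's theorem). On a fixed reference
    triangle, expanding 1 / (1 - lambda_j) as a geometric series gives
      I(alpha, beta + e_j) = sum_n I(alpha + n e_j, beta),
    and when two entries of beta vanish the integral is a product of two beta
    functions. These two facts determine I, hence its symmetry under
    permutations and its divergence when alpha_j + beta_j > |alpha| + 1. The
    linear relations used by ComputeI hold pointwise for the integrands, while
    those used by ComputeJ follow from the series by induction on beta_1, up to
    the value pi^2 / 3 of J(0, 0, 1, 1), which is the Basel problem. *)

Set Implicit Arguments.
Unset Strict Implicit.
Unset Printing Implicit Defensive.
Import Order.TTheory GRing.Theory Num.Theory.
Import numFieldNormedType.Exports.
Local Open Scope classical_set_scope.
Local Open Scope ring_scope.

(** The obstacle is arithmetic in [0, +oo]: [ComputeI] and [ComputeJ] subtract returned values and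
    multiply them by possibly negative coefficients, which gives the moment only when these values
    are finite. The identities between moments are therefore proved as sums of nonnegative terms,
    and the inductions carry a second claim: inputs that pass the test for +oo have a finite moment.
    An identity can be solved for the wanted moment once its other terms are known to be finite. The
    case distinction of [ComputeI] has the same origin. Lowering alpha_0 and raising alpha_j with
    beta kept makes the moment infinite exactly when alpha_j + beta_j = |alpha| + 1. If this occurs
    for both j = 1 and j = 2, both entries are raised at once, through (1 - lambda_1)(1 - lambda_2)
    = lambda_0 + lambda_1 lambda_2. As [returns] quantifies over all ways to break ties, the part of
    each algorithm after the sort is verified for an arbitrary sorted input, and the symmetry of the
    moments brings the result back to the original order. *)

(** * Affine change of variable on the line *)

Section AffineSubstitution.
Variable R : realType.
Notation mu := (@lebesgue_measure R).
Local Open Scope ereal_scope.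

Lemma measurable_affine1 (a c : R) :
  measurable_fun setT (fun x : measurableTypeR R =>
    (a * x + c)%R : measurableTypeR R).
Proof. by apply: measurable_funD => //; apply: measurable_funM. Qed.

(** Both sides are measures in [A], so uniqueness of Lebesgue measure reduces the claim to half-open
    intervals. *)
Lemma lebesgue_measure_affine (a c : R) (A : set (measurableTypeR R)) :
  a != 0%R -> measurable A ->
  mu A = `|a|%:E * mu ((fun x => a * x + c)%R @^-1` A).
Proof.
move=> a0 mA.
have an : (0 <= `|a|)%R by [].
have mf := measurable_affine1 a c.
pose phi := (fun x : measurableTypeR R => (a * x + c)%R : measurableTypeR R).
pose nu : {measure set (measurableTypeR R) -> \bar R} :=
  mscale (NngNum an) (measure_function_pushforward__canonical__measure_function_Measure mu mf).
suff : mu A = nu A by [].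
apply: lebesgue_measure_unique => // _ [[x y]] _ <-.
rewrite -[nu _]/(`|a|%:E * mu (phi @^-1` `]x, y]%classic)).
rewrite -[[set` _]]/(`]x, y]%classic).
have [ap|an0|] := ltgtP a 0%R; last by move/eqP: a0.
(* A negative slope exchanges the endpoints, so the closed end is now on the left; the length is not
   affected. *)
- have -> : phi @^-1` `]x, y]%classic = `[((y - c) / a)%R, ((x - c) / a)%R[%classic.
    apply/seteqP; split=> z; rewrite /= !in_itv /phi /= => /andP[h1 h2];
      apply/andP; split.
    + by rewrite ler_ndivrMr // mulrC; lra.
    + by rewrite ltr_ndivlMr // mulrC; lra.
    + by move: h2; rewrite ltr_ndivlMr // mulrC; lra.
    + by move: h1; rewrite ler_ndivrMr // mulrC; lra.
  rewrite !lebesgue_measure_itv /= !lte_fin ltr_nM2r ?invr_lt0 // ltrD2r.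
  case: ifP => _; last by rewrite mule0.
  rewrite -!EFinD -EFinM ltr0_norm //; congr EFin; field.
  exact: a0.
- have -> : phi @^-1` `]x, y]%classic = `]((x - c) / a)%R, ((y - c) / a)%R]%classic.
    apply/seteqP; split=> z; rewrite /= !in_itv /phi /= => /andP[h1 h2];
      apply/andP; split.
    + by rewrite ltr_pdivrMr // mulrC; lra.
    + by rewrite ler_pdivlMr // mulrC; lra.
    + by move: h1; rewrite ltr_pdivrMr // mulrC; lra.
    + by move: h2; rewrite ler_pdivlMr // mulrC; lra.
  rewrite !lebesgue_measure_itv /= !lte_fin ltr_pM2r ?invr_gt0 // ltrD2r.
  case: ifP => _; last by rewrite mule0.
  rewrite -!EFinD -EFinM gtr0_norm //; congr EFin; field.
  exact: a0.
Qed.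

Lemma ge0_integral_affine (a c : R) (h : measurableTypeR R -> \bar R) :
  a != 0%R -> measurable_fun setT h -> (forall x, 0 <= h x) ->
  \int[mu]_x h (a * x + c)%R = `|a|^-1%:E * \int[mu]_x h x.
Proof.
move=> a0 mh h0.
have an : (0 <= `|a|)%R by [].
have mf := measurable_affine1 a c.
pose phi := (fun x : measurableTypeR R => (a * x + c)%R : measurableTypeR R).
pose nu : {measure set (measurableTypeR R) -> \bar R} :=
  mscale (NngNum an) (measure_function_pushforward__canonical__measure_function_Measure mu mf).
have -> : \int[mu]_x h x = \int[nu]_x h x.
  by apply: eq_measure_integral => A mA _; exact: lebesgue_measure_affine.
rewrite ge0_integral_mscale // ge0_integral_pushforward //.
rewrite muleA -EFinM mulVf ?mul1e ?normr_eq0 //.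
Qed.

End AffineSubstitution.

(** * Affine change of variables in the plane *)

Section AffineSubstitution2.
Variable R : realType.
Notation mu := (@lebesgue_measure R).
Local Open Scope ereal_scope.
Notation T := (measurableTypeR R).

Lemma lebesgue2_tonelli1 (h : T * T -> \bar R) :
  measurable_fun setT h -> (forall p, 0 <= h p) ->
  \int[@lebesgue2 R]_p h p = \int[mu]_x \int[mu]_y h (x, y).
Proof. by move=> mh h0; exact: fubini_tonelli1. Qed.

Lemma lebesgue2_tonelli2 (h : T * T -> \bar R) :
  measurable_fun setT h -> (forall p, 0 <= h p) ->
  \int[@lebesgue2 R]_p h p = \int[mu]_y \int[mu]_x h (x, y).
Proof. by move=> mh h0; exact: fubini_tonelli2. Qed.

Lemma measurable_affine2 (a b e : R) :
  measurable_fun setT (fun p : T * T => (a * p.1 + b * p.2 + e)%R : T).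
Proof.
apply: measurable_funD => //; apply: measurable_funD; apply: measurable_funM => //.
Qed.

Lemma measurable_affine2_pair (a b e c d f : R) :
  measurable_fun setT (fun p : T * T =>
    ((a * p.1 + b * p.2 + e)%R : T, (c * p.1 + d * p.2 + f)%R : T)).
Proof. by apply/measurable_fun_pairP; split; exact: measurable_affine2. Qed.

(** For fixed y, substitute u = a x + b y + e. The second coordinate becomes k u + (D / a) y + (f -
    k e), where k = c / a and D is the determinant. After an exchange of the integrals, y is
    substituted for fixed u; the factors 1 / |a| and |a| / |D| multiply to 1 / |D|. *)
Let affine2_neq0 (a b e c d f : R) (h : T * T -> \bar R) :
  a != 0%R -> (a * d - b * c != 0)%R ->
  measurable_fun setT h -> (forall x, 0 <= h x) ->
  \int[@lebesgue2 R]_p h (a * p.1 + b * p.2 + e, c * p.1 + d * p.2 + f)%R =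
  `|a * d - b * c|^-1%:E * \int[@lebesgue2 R]_p h p.
Proof.
move=> a0 D0 mh h0.
pose k := (c / a)%R.
have mk : measurable_fun setT (fun p : T * T =>
    h (p.1, k * p.1 + ((a * d - b * c) / a) * p.2 + (f - k * e))%R).
  apply: (measurableT_comp mh).
  by apply/measurable_fun_pairP; split; [exact: measurable_fst|exact:
    measurable_affine2].
rewrite lebesgue2_tonelli2 //; last first.
  by apply: (measurableT_comp mh); exact: measurable_affine2_pair.
transitivity (\int[mu]_y (`|a|^-1%:E * \int[mu]_x
   h (x, k * x + ((a * d - b * c) / a) * y + (f - k * e))%R)).
  apply: eq_integral => y _ /=.
  rewrite -(@ge0_integral_affine _ a (b * y + e) (fun x => h (x, _)))//; last first.
    exact: (measurable_fun_pair1 y mk).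
  apply: eq_integral => x _; congr (h (_, _)); first by rewrite addrA.
  by rewrite /k; field.
rewrite ge0_integralZl //; first last.
- by move=> y _; exact: integral_ge0.
- exact: (measurable_fun_fubini_tonelli_G _ mk (fun p => h0 _)).
have := @lebesgue2_tonelli2 _ mk (fun p => h0 _) => /= <-.
rewrite lebesgue2_tonelli1 //=.
transitivity (`|a|^-1%:E * \int[mu]_x (`|(a * d - b * c) / a|^-1%:E * \int[mu]_y
  h (x, y))).
  congr (_ * _); apply: eq_integral => x _.
  rewrite -(@ge0_integral_affine _ ((a * d - b * c) / a) (k * x + (f - k * e))
    (fun y => h (x, y)))//.
  - by apply: eq_integral => y _; congr (h (_, _)); ring.
  - by rewrite mulf_neq0 ?invr_eq0.
  - exact: (measurable_fun_pair2 x mh).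
rewrite ge0_integralZl //; first last.
- by move=> y _; exact: integral_ge0.
- exact: (measurable_fun_fubini_tonelli_F _ mh h0).
rewrite -lebesgue2_tonelli1 // muleA -EFinM; congr (_%:E * _).
by rewrite normrM normfV -invfM mulrCA divff ?normr_eq0 // mulr1.
Qed.

Lemma ge0_integral_affine2 (a b e c d f : R) (h : T * T -> \bar R) :
  (a * d - b * c != 0)%R ->
  measurable_fun setT h -> (forall x, 0 <= h x) ->
  \int[@lebesgue2 R]_p h (a * p.1 + b * p.2 + e, c * p.1 + d * p.2 + f)%R =
  `|a * d - b * c|^-1%:E * \int[@lebesgue2 R]_p h p.
Proof.
move=> D0 mh h0; have [a0|a0] := eqVneq a 0%R; last exact: affine2_neq0.
(* Exchanging the two coordinates puts the nonzero [b] in the place of [a]. The determinant only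
   changes sign. *)
have b0 : b != 0%R by apply: contraNneq D0 => ->; rewrite a0 !mul0r subrr.
have ms : measurable_fun setT (fun p : T * T =>
    h (b * p.1 + a * p.2 + e, d * p.1 + c * p.2 + f)%R).
  by apply: (measurableT_comp mh); exact: measurable_affine2_pair.
have ms' : measurable_fun setT (fun p : T * T =>
  h (a * p.1 + b * p.2 + e, c * p.1 + d * p.2 + f)%R).
  by apply: (measurableT_comp mh); exact: measurable_affine2_pair.
rewrite lebesgue2_tonelli2 //.
rewrite distrC -(affine2_neq0 e f) //; last by rewrite -oppr_eq0 opprB.
rewrite lebesgue2_tonelli1 //.
apply: eq_integral => x _; apply: eq_integral => y _ /=.
by congr (h (_ + _, _ + _)%R); rewrite addrC.
Qed.

End AffineSubstitution2.

(** * The reference triangle and its null boundary *)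

Section ReferenceTriangle.
Variable R : realType.
Notation mu := (@lebesgue_measure R).
Notation T := (measurableTypeR R).
Implicit Types (a b : {ffun 'I_3 -> nat}) (j k : 'I_3) (p : T * T).

Lemma big_I3 (V : nmodType) (F : 'I_3 -> V) : \sum_j F j = F i0 + F i1 + F i2.
Proof.
rewrite !big_ord_recl big_ord0 addr0 addrA.
by congr (F _ + F _ + F _); apply/val_inj.
Qed.

Lemma sumn_I3 (F : 'I_3 -> nat) : (\sum_j F j)%N = (F i0 + F i1 + F i2)%N.
Proof. exact: (big_I3 F). Qed.

Lemma prod_I3 (F : 'I_3 -> R) : \prod_j F j = F i0 * F i1 * F i2.
Proof.
rewrite !big_ord_recl big_ord0 mulr1 mulrA.
by congr (F _ * F _ * F _); apply/val_inj.
Qed.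

Lemma I3P (P : 'I_3 -> Prop) : P i0 -> P i1 -> P i2 -> forall j, P j.
Proof.
move=> P0 P1 P2 [[|[|[|//]]] h].
- by have -> : Ordinal h = i0 by exact/val_inj.
- by have -> : Ordinal h = i1 by exact/val_inj.
- by have -> : Ordinal h = i2 by exact/val_inj.
Qed.

(** The Cartesian coordinates are lambda_0 and lambda_2, so that 1 - lambda_2 is constant on
    horizontal slices: the integral factors when only the exponent at [i2] of the denominator is
    nonzero. *)
Definition ref_bary j p : R := [:: p.1; 1 - p.1 - p.2; p.2]`_j.

Definition ref_triangle : set (T * T) := [set p | forall j, 0 <= ref_bary j p].

Definition ref_interior : set (T * T) := [set p | forall j, 0 < ref_bary j p].

(* The factor 2 is the inverse of the area of the reference triangle. The open
   triangle avoids the vertices, where 1 - lambda_j vanishes. *)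
Definition moment a b : \bar R :=
  (2%:E * \int[@lebesgue2 R]_(p in ref_interior) (integrand ref_bary a b p)%:E)%E.

Lemma ref_bary_sum p : \sum_j ref_bary j p = 1.
Proof. by rewrite big_I3 /ref_bary /=; ring. Qed.

Lemma ref_bary_ge0_le1 p : ref_triangle p -> forall j, 0 <= ref_bary j p <= 1.
Proof.
move=> Dp j; rewrite Dp /=.
rewrite -(ref_bary_sum p) (bigD1 j) //= lerDl.
by apply: sumr_ge0 => k _; exact: Dp.
Qed.

Lemma sub_ref_interior : ref_interior `<=` ref_triangle.
Proof. by move=> p Dp j; exact/ltW/Dp. Qed.

Lemma ref_bary_lt1 p : ref_interior p -> forall j, ref_bary j p < 1.
Proof.
move=> Dp; have := ref_bary_sum p; rewrite big_I3.
have := Dp i0; have := Dp i1; have := Dp i2 => h0 h1 h2 h.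
by apply: I3P; lra.
Qed.

Lemma integrand_ge0 a b p : ref_triangle p -> 0 <= integrand ref_bary a b p.
Proof.
move=> Dp; rewrite divr_ge0 //; apply: prodr_ge0 => j _; apply: exprn_ge0.
- exact: Dp.
- by rewrite subr_ge0; have /andP[] := ref_bary_ge0_le1 Dp j.
Qed.

Lemma measurable_ref_bary j : measurable_fun setT (ref_bary j : T * T -> T).
Proof.
move: j; apply: I3P; rewrite /ref_bary /=.
- exact: measurable_fst.
- apply: measurable_funB; [|exact: measurable_snd].
  by apply: measurable_funB; [exact: measurable_cst|exact: measurable_fst].
- exact: measurable_snd.
Qed.

Lemma measurable_invr : measurable_fun setT (fun x : R => x^-1).
Proof.
(* Squaring makes the base of the real power nonnegative, where the exponent -1 gives the inverse.
   At 0 both sides are 0. *)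
rewrite (_ : (fun _ => _) = (fun x : R => (x ^+ 2) `^ (-1) * x)).
  apply: measurable_funM => //.
  exact: (@measurableT_comp _ _ _ _ _ _ (fun x : R => x `^ (-1)) _ (fun x : R =>
    x ^+ 2)).
apply/funext => x; rewrite powR_inv1 ?sqr_ge0 //.
have [->|x0] := eqVneq x 0; first by rewrite invr0 mulr0.
by field.
Qed.

Lemma measurable_integrand a b :
  measurable_fun setT (integrand ref_bary a b : T * T -> R).
Proof.
apply: measurable_funM.
  apply: measurable_prod => j _; apply: measurable_funX.
  exact: measurable_ref_bary.
apply: (measurableT_comp measurable_invr).
apply: measurable_prod => j _; apply: measurable_funX.
apply: measurable_funB; first exact: measurable_cst.
exact: measurable_ref_bary.
Qed.

Lemma measurable_ref_triangle : measurable ref_triangle.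
Proof.
have -> : ref_triangle = \bigcap_(j in [set: 'I_3])
    (ref_bary j @^-1` `[0, +oo[%classic).
  apply/seteqP; split=> p h j; first by move=> _ /=; rewrite in_itv /= andbT;
    exact: h.
  by have := h j I; rewrite /= in_itv /= andbT.
apply: fin_bigcap_measurable => // j _.
by rewrite -[X in measurable X]setTI; exact: measurable_ref_bary.
Qed.

Lemma measurable_ref_interior : measurable ref_interior.
Proof.
have -> : ref_interior = \bigcap_(j in [set: 'I_3])
    (ref_bary j @^-1` `]0, +oo[%classic).
  apply/seteqP; split=> p h j; first by move=> _ /=; rewrite in_itv /= andbT;
    exact: h.
  by have := h j I; rewrite /= in_itv /= andbT.
apply: fin_bigcap_measurable => // j _.
by rewrite -[X in measurable X]setTI; exact: measurable_ref_bary.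
Qed.

Lemma measurable_edge_line j : measurable (ref_bary j @^-1` [set 0 : T]).
Proof. by rewrite -[X in measurable X]setTI; exact: measurable_ref_bary. Qed.

(** For [i0] the line is the rectangle {0} x R; the other two lines meet every vertical line in a
    single point. *)
Lemma lebesgue2_edge_line j : lebesgue2 (ref_bary j @^-1` [set 0 : T]) = 0%E.
Proof.
rewrite /lebesgue2; move: j; apply: I3P; rewrite /ref_bary /=.
- have -> : (fun p : T * T => p.1 : T) @^-1` [set 0 : T] = [set 0 : T] `*` [set: T].
    by apply/seteqP; split=> p //= [].
  by rewrite product_measure1E // [X in (X * _)%E]lebesgue_measure_set1 mul0e.
- rewrite /product_measure1; apply: integral0_eq => x _ /=.
  rewrite [X in mu X](_ : _ = [set 1 - x]) ?lebesgue_measure_set1 //.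
  apply/seteqP; split=> y; rewrite /xsection /= in_setE /=; first by lra.
  by move=> ->; rewrite subrr.
- rewrite /product_measure1; apply: integral0_eq => x _ /=.
  rewrite [X in mu X](_ : _ = [set 0]) ?lebesgue_measure_set1 //.
  by apply/seteqP; split=> y; rewrite /xsection /= in_setE.
Qed.

(** The two domains differ by points of the three edge lines, which are null. This connects [Ival],
    taken over the closed triangle, with [moment]. *)
Lemma integral_ref_triangle (f : T * T -> \bar R) :
  measurable_fun setT f -> (forall p, ref_triangle p -> (0 <= f p)%E) ->
  (\int[@lebesgue2 R]_(p in ref_triangle) f p =
   \int[@lebesgue2 R]_(p in ref_interior) f p)%E.
Proof.
move=> mf f0.
have mT := measurable_ref_triangle; have mI := measurable_ref_interior.
rewrite (@ge0_negligible_integral _ _ _ _ _ (ref_triangle `\` ref_interior)) //.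
- by rewrite setDD setIidr //; exact: sub_ref_interior.
- exact: measurableD.
- exact: measurable_funTS.
have mL := @measurable_edge_line.
apply: (@subset_measure0 _ _ _ _ _ (ref_bary i0 @^-1` [set 0 : T] `|`
  ref_bary i1 @^-1` [set 0 : T] `|` ref_bary i2 @^-1` [set 0 : T])).
- exact: measurableD.
- by apply: measurableU; [apply: measurableU|]; exact: mL.
- move=> p [Tp /existsNP[j jp]].
  have : ref_bary j p = 0.
    by apply/eqP; rewrite eq_le Tp andbT leNgt; exact/negP.
  by move: j {jp}; apply: I3P => jp; [left; left|left; right|right].
- apply: null_set_setU; [by apply: measurableU;
    exact: mL|exact: mL| |exact: lebesgue2_edge_line].
  by apply: null_set_setU; [exact: mL|exact: mL|exact:
    lebesgue2_edge_line|exact: lebesgue2_edge_line].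
Qed.

End ReferenceTriangle.

(** * Moments that are products of two beta functions *)

Section BetaMoment.
Variable R : realType.
Notation mu := (@lebesgue_measure R).
Notation T := (measurableTypeR R).
Implicit Types (a b : {ffun 'I_3 -> nat}).

Lemma integral_XMonemX_oo m n :
  (\int[mu]_(x in `]0%R, 1%R[) (XMonemX m n x)%:E = (beta_fun m.+1 n.+1)%:E)%E.
Proof.
have mX : measurable_fun setT (EFin \o (@XMonemX R m n)).
  by apply/measurable_EFinP; exact: measurable_XMonemX.
rewrite EFin_beta_fun /= -(@integral_itv_bndoo _ _ _ _ true false); last first.
  exact: measurable_funTS mX.
rewrite [LHS]integral_mkcond; apply: eq_integral => x _.
by rewrite !patchE; case: ifP.
Qed.

Let measurable_XMonemX_oo m n :
  measurable_fun setT ((EFin \o (@XMonemX R m n))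
    \_ `]0%R, 1%R[%classic : T -> \bar R).
Proof.
apply: (measurable_restrictT _ (measurable_itv _)).1.
by apply: measurable_funTS; apply/measurable_EFinP; exact: measurable_XMonemX.
Qed.

Lemma moment_beta a b :
  b i0 = 0%N -> b i1 = 0%N -> (b i2 <= a i0 + a i1 + 1)%N ->
  moment R a b = (2 * (beta_fun (a i0).+1 (a i1).+1 *
                  beta_fun (a i2).+1 (a i0 + a i1 + 1 - b i2).+1))%:E.
Proof.
move=> b00 b10 b2; set c := (_ - _)%N.
rewrite /moment EFinM; congr (_ * _)%E.
pose f (p : T * T) := ((EFin \o (integrand (@ref_bary R) a b)) \_ (@ref_interior
  R)) p.
have f0 p : (0 <= f p)%E.
  rewrite /f patchE; case: ifPn => // /set_mem Dp.
  by rewrite lee_fin; apply/integrand_ge0/sub_ref_interior.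
have mf : measurable_fun setT f.
  apply: (measurable_restrictT _ (@measurable_ref_interior R)).1.
  by apply: measurable_funTS; apply/measurable_EFinP; exact: measurable_integrand.
rewrite integral_mkcond -/f lebesgue2_tonelli2 //.
transitivity (\int[mu]_y (((EFin \o XMonemX (a i2) c) \_ `]0%R, 1%R[%classic) y *
   (beta_fun (a i0).+1 (a i1).+1)%:E))%E; last first.
  rewrite ge0_integralZr //; first last.
  - by rewrite lee_fin beta_fun_ge0.
  - move=> y _; rewrite patchE; case: ifPn => // /set_mem /=;
      rewrite in_itv /= => /andP[y0 y1].
    by rewrite lee_fin XMonemX_ge0 // in_itv /= !ltW.
  by rewrite -integral_mkcond integral_XMonemX_oo -EFinM mulrC.
apply: eq_integral => y _.
rewrite patchE; case: ifPn => [/set_mem|/negP yout].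
  rewrite /= in_itv /= => /andP[y0 y1].
  have y1' : 1 - y != 0 by rewrite subr_eq0 gt_eqF.
  rewrite -integral_XMonemX_oo [X in (_ * X)%E]integral_mkcond.
  (* The dilation by 1 - y maps ]0, 1[ onto the slice at height y. Its Jacobian 1 - y accounts for
     the [+ 1] in the exponent [c]. *)
  have := @ge0_integral_affine R (1 - y) 0 (fun x =>
    f (x, y)) y1' (measurable_fun_pair1 y mf) (fun x => f0 _).
  rewrite gtr0_norm ?subr_gt0 // => h.
  have -> : (\int[mu]_x f (x, y) = (1 - y)%:E * \int[mu]_x f ((1 - y) * x + 0,
    y)%R)%E.
    by rewrite h muleA -EFinM divff // mul1e.
  rewrite -!ge0_integralZl //=; first last.
  - by rewrite lee_fin XMonemX_ge0 // in_itv /= !ltW.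
  - move=> x _; rewrite patchE; case: ifPn => // /set_mem /=;
      rewrite in_itv /= => /andP[x0 x1].
    by rewrite lee_fin XMonemX_ge0 // in_itv /= !ltW.
  - exact: measurable_XMonemX_oo.
  - by rewrite lee_fin subr_ge0 ltW.
  - have := measurable_fun_pair1 y mf => my.
    by apply: (measurableT_comp my); exact: measurable_affine1.
  apply: eq_integral => x _.
  have xE : (((1 - y) * x + 0, y) \in @ref_interior R) =
    (x \in `]0%R, 1%R[%classic).
    apply/idP/idP => /set_mem.
      move=> /= D; apply/mem_set; rewrite /= in_itv /=.
      have := D i0; have := D i1; rewrite /ref_bary /= => h1 h2.
      have : 0 < (1 - y) * x by lra.
      rewrite pmulr_rgt0 ?subr_gt0 // => -> /=.
      have : 0 < (1 - y) * (1 - x) by lra.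
      by rewrite pmulr_rgt0 ?subr_gt0.
    rewrite /= in_itv /= => /andP[x0 x1]; apply/mem_set => /=.
    have h1 : 0 < (1 - y) * x by rewrite mulr_gt0 // subr_gt0.
    have h2 : 0 < (1 - y) * (1 - x) by rewrite mulr_gt0 // subr_gt0.
    by apply: I3P; rewrite /ref_bary /=; lra.
  rewrite /f !patchE xE; case: ifPn => _; last by rewrite !mule0.
  rewrite /= -!EFinM; congr EFin.
  rewrite /integrand !prod_I3 b00 b10 /ref_bary /= !expr0 !mul1r /XMonemX addr0.
  rewrite (_ : 1 - (1 - y) * x - y = (1 - y) * (1 - x)); last by ring.
  rewrite !exprMn.
  have -> : (1 - y) ^+ c = (1 - y) ^+ a i0 * (1 - y) ^+ a i1 * (1 - y) / (1 - y)
    ^+ b i2.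
    by rewrite -exprD -exprSr -addn1 /c expfB_cond // (negbTE y1').
  by field; rewrite expf_neq0.
rewrite mul0e; apply: integral0_eq => x _; rewrite /f patchE ifN //.
apply/negP => /set_mem D; apply: yout; apply/mem_set; rewrite /= in_itv /=.
have := D i0; have := D i1; have := D i2; rewrite /ref_bary /= => h2 h1 h0.
by apply/andP; split; lra.
Qed.

Lemma moment_fact a b :
  b i0 = 0%N -> b i1 = 0%N -> (b i2 <= a i0 + a i1 + 1)%N ->
  moment R a b =
  (2 * ((a i0)`!%:R * (a i1)`!%:R * (a i2)`!%:R * (a i0 + a i1 + 1 - b i2)`!%:R /
    ((a i0 + a i1 + 1)`!%:R * (\sum_j a j + 2 - b i2)`!%:R)))%:E.
Proof.
move=> b0 b1 b2; rewrite moment_beta // !beta_fun_fact; congr (_ * _)%:E.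
rewrite sumn_I3.
have -> : (a i2 + (a i0 + a i1 + 1 - b i2)).+1 = (a i0 + a i1 + a i2 + 2 - b i2)%N.
  by rewrite addnBA // -subSn; [congr subn; ring|apply: leq_trans b2 _;
    rewrite leq_addl].
rewrite (natrM _ (a i0)`!) (natrM _ (a i2)`!) addn1.
by rewrite mulrACA -!mulrA invfM; congr (_ * (_ * _)); rewrite !mulrA mulrAC.
Qed.

End BetaMoment.

(** * Reduction of an arbitrary triangle to the reference triangle *)

Section TriangleToReference.
Variable R : realType.
Notation mu := (@lebesgue_measure R).
Notation T := (measurableTypeR R).
Variables (v : 'I_3 -> R * R) (lam : 'I_3 -> R * R -> R).
Hypotheses (hv : noncollinear v) (hlam : barycentric v lam).

Let det_kernel (x y u w u' w' : R) :
  u * w' - u' * w != 0 -> x * u + y * w = 0 -> x * u' + y * w' = 0 ->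
  x = 0 /\ y = 0.
Proof.
move=> D h h'; split; apply: (mulfI D); rewrite mulr0.
- by have : w' * (x * u + y * w) - w * (x * u' + y * w') = 0;
    [rewrite h h' !mulr0 subrr|move=> <-; ring].
- by have : u * (x * u' + y * w') - u' * (x * u + y * w) = 0;
    [rewrite h h' !mulr0 subrr|move=> <-; ring].
Qed.

(** The sum is affine and equals 1 at the three vertices. Its linear part thus vanishes on two edge
    vectors, which are independent, and the sum is constant. *)
Lemma barycentric_sum p : \sum_j lam j p = 1.
Proof.
rewrite big_I3; case: hlam => aff val.
have [[a0 [b0 [c0 l0]]] [[a1 [b1 [c1 l1]]] [a2 [b2 [c2 l2]]]]] :=
  (aff i0, (aff i1, aff i2)).
have sumv k : lam i0 (v k) + lam i1 (v k) + lam i2 (v k) = 1.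
  by rewrite !val; move: k; apply: I3P; rewrite /= ?addr0 ?add0r.
have := sumv i0; have := sumv i1; have := sumv i2.
rewrite !l0 !l1 !l2 => e2 e1 e0.
have [||A0 B0] := @det_kernel (a0 + a1 + a2) (b0 + b1 + b2) _ _ _ _ hv; [lra|lra|].
transitivity ((a0 + a1 + a2) * p.1 + (b0 + b1 + b2) * p.2 + (c0 + c1 + c2));
  first ring.
rewrite A0 B0 !mul0r !add0r -e0.
transitivity ((a0 + a1 + a2) * (v i0).1 + (b0 + b1 + b2) * (v i0).2 + (c0 + c1 +
  c2)); last ring.
by rewrite A0 B0 !mul0r !add0r.
Qed.

Lemma barycentric_ref j p : lam j p = ref_bary j (lam i0 p, lam i2 p).
Proof.
have := barycentric_sum p; rewrite big_I3 => s.
by move: j; apply: I3P; rewrite /ref_bary //=; lra.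
Qed.

Lemma barycentric_affine02 : exists a b e c d f : R,
  [/\ a * d - b * c != 0, forall p, lam i0 p = a * p.1 + b * p.2 + e &
      forall p, lam i2 p = c * p.1 + d * p.2 + f].
Proof.
case: hlam => aff val.
have [[a [b [e l0]]] [c [d [f l2]]]] := (aff i0, aff i2).
exists a, b, e, c, d, f; split => //.
(* Multiplicativity of determinants: the linear part of (lambda_0, lambda_2) maps the edge vectors
   at [v i0] to (-1, 0) and (-1, 1). *)
have D : (a * d - b * c) * (((v i1).1 - (v i0).1) * ((v i2).2 - (v i0).2)
  - ((v i2).1 - (v i0).1) * ((v i1).2 - (v i0).2)) = -1.
  transitivity ((lam i0 (v i1) - lam i0 (v i0)) * (lam i2 (v i2) - lam i2 (v i0)) -
     (lam i0 (v i2) - lam i0 (v i0)) * (lam i2 (v i1) - lam i2 (v i0))).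
    by rewrite !l0 !l2; ring.
  by rewrite !val /=; ring.
by apply: contra_eq_neq D => ->; rewrite mul0r eq_sym oppr_eq0 oner_eq0.
Qed.

Lemma triangle_barycentric p : triangle v p <-> ref_triangle (lam i0 p, lam i2 p).
Proof.
have [a [b [e [c [d [f [D l0 l2]]]]]]] := barycentric_affine02.
case: hlam => aff val; split.
- case=> t [t0 t1 ->] j; rewrite -barycentric_ref.
  suff -> : lam j (\sum_k t k * (v k).1, \sum_k t k * (v k).2) = t j by exact: t0.
  have [x [y [z lj]]] := aff j.
  transitivity (\sum_k t k * lam j (v k)).
    move: t1; rewrite !big_I3 !lj /= => t1.
    rewrite -[z in LHS]mul1r -t1; ring.
  rewrite (bigD1 j) //= val eqxx mulr1 big1 ?addr0 // => k kj.
  by rewrite val eq_sym (negbTE kj) mulr0.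
- move=> Tp; exists (fun j => lam j p); split.
  + by move=> j; rewrite barycentric_ref; exact: Tp.
  + exact: barycentric_sum.
  (* The convex combination [q] with weights [lam j p] has the same barycentric coordinates as [p];
     since (lambda_0, lambda_2) is injective, [q] is [p]. *)
  pose q := (\sum_j lam j p * (v j).1, \sum_j lam j p * (v j).2).
  have lq j : (exists x y z, forall r, lam j r =
    x * r.1 + y * r.2 + z) -> lam j q = lam j p.
    case=> x [y [z lj]].
    transitivity (\sum_k lam k p * lam j (v k)).
      have := barycentric_sum p; rewrite /q !big_I3 !(lj (_, _)).
      rewrite !(lj (v _)) /= => t1.
      rewrite -[z in LHS]mul1r -t1; ring.
    rewrite (bigD1 j) //= val eqxx mulr1 big1 ?addr0 // => k kj.
    by rewrite val eq_sym (negbTE kj) mulr0.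
  have := lq i0 (aff _); have := lq i2 (aff _); rewrite !l0 !l2 => h2 h0.
  have [|||E1 E2] := @det_kernel (q.1 - p.1) (q.2 - p.2) a b c d.
  + by rewrite (mulrC c).
  + by lra.
  + by lra.
  by rewrite -/q [LHS]surjective_pairing [RHS]surjective_pairing; congr pair; lra.
Qed.

Lemma integrand_barycentric a b p :
  integrand lam a b p = integrand (@ref_bary R) a b (lam i0 p, lam i2 p).
Proof.
by rewrite /integrand; congr (_ / _); apply: eq_bigr => j _;
  rewrite barycentric_ref.
Qed.

Lemma integral_triangle : exists2 k : R, 0 < k & forall a b,
  (\int[@lebesgue2 R]_(p in triangle v) (integrand lam a b p)%:E =
   k%:E * \int[@lebesgue2 R]_(p in @ref_interior R) (integrand (@ref_bary R) a b
     p)%:E)%E.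
Proof.
have [a [b [e [c [d [f [D l0 l2]]]]]]] := barycentric_affine02.
exists `|a * d - b * c|^-1; first by rewrite invr_gt0 normr_gt0.
move=> al be.
pose h := (EFin \o (integrand (@ref_bary R) al be)) \_ (@ref_triangle R).
have mi : measurable_fun setT (EFin \o (integrand (@ref_bary R) al be)).
  by apply/measurable_EFinP; exact: measurable_integrand.
have mh : measurable_fun setT h.
  apply: (measurable_restrictT _ (@measurable_ref_triangle R)).1.
  exact: measurable_funTS.
have gi0 p : ref_triangle p -> (0 <= (EFin \o (integrand (@ref_bary R) al be)) p)%E.
  by move=> Tp; rewrite lee_fin integrand_ge0.
have h0 p : (0 <= h p)%E.
  by rewrite /h patchE; case: ifPn => // /set_mem; exact: gi0.
rewrite -(integral_ref_triangle mi gi0) [X in (_ * X)%E]integral_mkcond -/h.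
rewrite -(ge0_integral_affine2 e f D mh h0) [LHS]integral_mkcond.
apply: eq_integral => p _; rewrite /h !patchE /= -l0 -l2 -integrand_barycentric.
suff -> : (p \in triangle v) = ((lam i0 p, lam i2 p) \in @ref_triangle R) by [].
by apply/idP/idP => /set_mem h1; apply/mem_set/triangle_barycentric.
Qed.

(** The same Jacobian [k] scales all these integrals. With all exponents 0 the integral is the area,
    which is therefore [k / 2], and [k] cancels in the quotient. *)
Lemma Ival_moment a b : Ival v lam a b = moment R a b.
Proof.
have [k k0 ik] := integral_triangle.
have one p : integrand lam [ffun=> 0%N] [ffun=> 0%N] p = 1.
  by rewrite /integrand !prod_I3 !ffunE !expr0 !mulr1 divr1.
have one' p : integrand (@ref_bary R) [ffun=> 0%N] [ffun=> 0%N] p = 1.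
  by rewrite /integrand !prod_I3 !ffunE !expr0 !mulr1 divr1.
have half : (\int[@lebesgue2 R]_(p in @ref_interior R)
    (integrand (@ref_bary R) [ffun=> 0%N] [ffun=> 0%N] p)%:E = (2^-1)%:E)%E.
  have := @moment_beta R [ffun=> 0%N] [ffun=> 0%N].
  rewrite !ffunE !beta_fun_fact => /(_ erefl erefl isT) h.
  transitivity ((2^-1)%:E * moment R [ffun=> 0%N] [ffun=> 0%N])%E.
    by rewrite /moment muleA -EFinM mulVf ?mul1e // pnatr_eq0.
  rewrite h -EFinM; congr EFin.
  transitivity (2^-1 * (2 * (1 / 1 * (1 / 2))) : R); first by [].
  by field.
have mT : measurable (triangle v : set (T * T)).
  have [x [y [e [c [d [f [D l0 l2]]]]]]] := barycentric_affine02.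
  have -> : (triangle v : set (T * T)) =
      (fun p : T * T => (x * p.1 + y * p.2 + e,
        c * p.1 + d * p.2 + f) : T * T) @^-1` (@ref_triangle R).
    by apply/seteqP; split=> p; rewrite /preimage /= -l0 -l2 =>
      /triangle_barycentric.
  rewrite -[X in measurable X]setTI.
  by apply: measurable_affine2_pair => //; exact: measurable_ref_triangle.
have area : lebesgue2 (triangle v) = (k / 2)%:E.
  have := ik [ffun=> 0%N] [ffun=> 0%N]; rewrite half -EFinM => <-.
  rewrite -[LHS]mul1e -integral_cst //.
  by apply: eq_integral => p _; rewrite one.
rewrite /Ival area ik /moment muleA inver ifF; last first.
  by apply/negbTE; rewrite lt0r_neq0 // divr_gt0.
rewrite -EFinM; congr (_%:E * _)%E.
by field; rewrite gt_eqF.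
Qed.

End TriangleToReference.

(** * Linear relations and geometric series for moments *)

Section MomentLaws.
Variable R : realType.
Notation T := (measurableTypeR R).
Implicit Types (a b : {ffun 'I_3 -> nat}) (i j k : 'I_3) (n : nat) (p : T * T).
Notation g := (integrand (@ref_bary R)).

Definition addhatn a j n : {ffun 'I_3 -> nat} := [ffun i => (a i + n * (i == j))%N].

Lemma addhatC a i j : (a :+ i) :+ j = (a :+ j) :+ i.
Proof. by apply/ffunP => k; rewrite !ffunE addnAC. Qed.

Lemma integrand_addhatl a b i p : g (a :+ i) b p = ref_bary i p * g a b p.
Proof.
rewrite /integrand mulrA; congr (_ / _).
rewrite (bigD1 i) //= [in RHS](bigD1 i) //= ffunE eqxx addn1 exprS mulrA.
by congr (_ * _); apply: eq_bigr => j /negbTE ji; rewrite ffunE ji addn0.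
Qed.

Lemma integrand_addhatnl a b i n p : g (addhatn a i n) b p =
  ref_bary i p ^+ n * g a b p.
Proof.
rewrite /integrand mulrA; congr (_ / _).
rewrite (bigD1 i) //= [in RHS](bigD1 i) //= ffunE eqxx muln1 addnC exprD mulrA.
by congr (_ * _); apply: eq_bigr => j /negbTE ji; rewrite ffunE ji muln0 addn0.
Qed.

Lemma integrand_addhatr a b i p : ref_interior p ->
  g a b p = (1 - ref_bary i p) * g a (b :+ i) p.
Proof.
move=> Dp; have l1 : 1 - ref_bary i p != 0.
  by rewrite subr_eq0 eq_sym lt_eqF // ref_bary_lt1.
rewrite /integrand mulrCA; congr (_ * _).
rewrite (bigD1 i) //= [in RHS](bigD1 i) //= ffunE eqxx addn1 exprS -mulrA.
rewrite [in RHS]invfM mulVKf //.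
congr ((_ * _)^-1); apply: eq_bigr => j /negbTE ji; by rewrite ffunE ji addn0.
Qed.

Lemma moment_ge0 a b : (0 <= moment R a b)%E.
Proof.
apply: mule_ge0 => //; apply: integral_ge0 => p Dp.
by rewrite lee_fin; apply/integrand_ge0/sub_ref_interior.
Qed.

Let g_ge0 a b p : ref_interior p -> 0 <= g a b p.
Proof. by move=> Dp; apply/integrand_ge0/sub_ref_interior. Qed.

Let mean (f : T * T -> R) : \bar R :=
  (2%:E * \int[@lebesgue2 R]_(p in @ref_interior R) (f p)%:E)%E.

Let meanD (f h : T * T -> R) : measurable_fun setT f -> measurable_fun setT h ->
  (forall p, ref_interior p -> 0 <= f p) ->
  (forall p, ref_interior p -> 0 <= h p) ->
  mean (fun p => f p + h p) = (mean f + mean h)%E.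
Proof.
move=> mf mh f0 h0.
rewrite /mean -muleDr //; last first.
  by apply: ge0_adde_def; rewrite inE; apply: integral_ge0 => p Dp;
    rewrite lee_fin; auto.
congr (_ * _)%E; under eq_integral do rewrite EFinD.
rewrite ge0_integralD //.
- exact: measurable_ref_interior.
- by apply: measurable_funTS; exact/measurable_EFinP.
- by apply: measurable_funTS; exact/measurable_EFinP.
Qed.

Let eq_mean (f h : T * T -> R) : (forall p, ref_interior p -> f p =
  h p) -> mean f = mean h.
Proof.
move=> e; congr (_ * _)%E; apply: eq_integral => p /set_mem Dp.
by rewrite e.
Qed.

Let moment_split a b a1 b1 a2 b2 :
  (forall p, ref_interior p -> g a b p = g a1 b1 p + g a2 b2 p) ->
  moment R a b = (moment R a1 b1 + moment R a2 b2)%E.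
Proof.
move=> h; rewrite -[LHS]/(mean (g a b)) (eq_mean h) meanD //;
  try exact: measurable_integrand; exact: g_ge0.
Qed.

(** Integrates 1 - lambda_k = lambda_i + lambda_j. *)
Lemma moment_side a b (i j k : 'I_3) : i != j -> j != k -> k != i ->
  moment R a b = (moment R (a :+ i) (b :+ k) + moment R (a :+ j) (b :+ k))%E.
Proof.
move=> ij jk ki; apply: moment_split => p Dp.
rewrite !integrand_addhatl (integrand_addhatr a b k Dp) -mulrDl; congr (_ * _).
rewrite -(ref_bary_sum p) (bigD1 k) //= [LHS]addrC addKr.
rewrite (bigD1 i) //= 1?eq_sym //; rewrite (bigD1 j) //=; last by rewrite jk eq_sym.
rewrite big1 ?addr0 // => l; move: i j k l ij jk ki.
by do 4 (apply: I3P).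
Qed.

(** Integrates (1 - lambda_1)(1 - lambda_2) = lambda_0 + lambda_1 lambda_2. *)
Lemma moment_two_sides a b :
  moment R a b = (moment R (a :+ i0) (b :+ i1 :+ i2) + moment R (a :+ i1 :+ i2)
    (b :+ i1 :+ i2))%E.
Proof.
apply: moment_split => p Dp.
rewrite !integrand_addhatl (integrand_addhatr a b i1 Dp) (integrand_addhatr a (b
  :+ i1) i2 Dp).
have := ref_bary_sum p; rewrite big_I3 => s.
have -> : ref_bary i0 p = 1 - ref_bary i1 p - ref_bary i2 p by lra.
by ring.
Qed.

(** The three factors 1 - lambda_j add up to 2. *)
Lemma moment_corners a b :
  (moment R a (b :+ i1 :+ i2) + moment R a (b :+ i0 :+ i2) + moment R a (b :+ i0
    :+ i1) =
   moment R a (b :+ i0 :+ i1 :+ i2) + moment R a (b :+ i0 :+ i1 :+ i2))%E.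
Proof.
have mg := @measurable_integrand R.
have E b' : moment R a b' = mean (g a b') by [].
rewrite !E -(meanD (mg _ _) (mg _ _) (g_ge0 _ _) (g_ge0 _ _)).
rewrite -(meanD _ (mg _ _) _ (g_ge0 _ _)); first last.
- by move=> p Dp; rewrite addr_ge0 // g_ge0.
- by apply: measurable_funD; exact: mg.
rewrite -(meanD (mg _ _) (mg _ _) (g_ge0 _ _) (g_ge0 _ _)).
apply: eq_mean => p Dp.
rewrite (integrand_addhatr a (b :+ i1 :+ i2) i0 Dp) (addhatC (b :+ i1)) (addhatC b).
rewrite (integrand_addhatr a (b :+ i0 :+ i2) i1 Dp) (addhatC (b :+ i0) i2).
rewrite (integrand_addhatr a (b :+ i0 :+ i1) i2 Dp).
have := ref_bary_sum p; rewrite big_I3 => s.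
have -> : ref_bary i2 p = 1 - ref_bary i0 p - ref_bary i1 p by lra.
by ring.
Qed.

Lemma moment_addhatr a b j :
  moment R a (b :+ j) = (moment R a b + moment R (a :+ j) (b :+ j))%E.
Proof.
apply: moment_split => p Dp.
by rewrite integrand_addhatl (integrand_addhatr a b j Dp); ring.
Qed.

Lemma nneseries_geometric (c z : R) : 0 <= z < 1 ->
  (\sum_(n <oo) (z ^+ n * c)%:E = (c / (1 - z))%:E)%E.
Proof.
move=> /andP[z0 z1]; apply: cvg_lim => //.
rewrite (_ : (fun _ => _) = EFin \o series (geometric c z)).
  by apply: cvg_EFin; [exact: nearW|apply: cvg_geometric_series; rewrite ger0_norm].
apply/funext => n /=; rewrite /series /= sumEFin; congr EFin.
by apply: eq_bigr => k _; rewrite mulrC.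
Qed.

Lemma moment_series a b j :
  (moment R a (b :+ j) = \sum_(n <oo) moment R (addhatn a j n) b)%E.
Proof.
rewrite /moment nneseriesZl; last by move=> n _; apply: integral_ge0 => p Dp;
  rewrite lee_fin g_ge0.
congr (_ * _)%E; rewrite -integral_nneseries; first last.
- by move=> n p Dp; rewrite lee_fin g_ge0.
- by move=> n; apply: measurable_funTS; apply/measurable_EFinP;
    exact: measurable_integrand.
- exact: measurable_ref_interior.
apply: eq_integral => p /set_mem Dp.
have l1 := ref_bary_lt1 Dp j.
under eq_eseriesr do rewrite integrand_addhatnl.
rewrite nneseries_geometric ?l1 ?ltW ?Dp //; congr EFin.
rewrite (integrand_addhatr a b j Dp) mulrC mulKf //.
by rewrite subr_eq0 eq_sym lt_eqF.
Qed.


End MomentLaws.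

(** * The Basel problem *)

Section Basel.
Variable R : realType.
Notation pi := (@pi R).
Implicit Types (x : R) (n k : nat).

Lemma sin_le_id x : 0 <= x -> sin x <= x.
Proof.
move=> x0.
have [c _] := @MVT_segment R sin cos 0 x x0 (fun y _ => is_derive_sin y)
  (continuous_subspaceT (@continuous_sin R)).
rewrite sin0 !subr0 => ->; rewrite -[leRHS]mul1r.
by apply: ler_wpM2r => //; exact: cos_le1.
Qed.

Lemma mulr_cos_le_sin x : 0 <= x <= pi -> x * cos x <= sin x.
Proof.
move=> /andP[x0 xpi].
pose f (y : R) := sin y - y * cos y.
have df (y : R) : is_derive y 1 f (y * sin y).
  apply: is_derive_eq; rewrite /GRing.scale /=; ring.
have cf : continuous f.
  by move=> y; apply: differentiable_continuous; apply/derivable1_diffP;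
    case: (df y).
have [c] := @MVT_segment R f _ 0 x x0 (fun y _ => df y) (continuous_subspaceT cf).
rewrite in_itv /= /f sin0 mul0r subr0 !subr0 => /andP[c0 cx] e.
rewrite -subr_ge0 e mulr_ge0 // mulr_ge0 // sin_ge0_pi // c0 /=.
exact: le_trans xpi.
Qed.

(** From x cos x <= sin x <= x, since the lower bound is the square of cos x / sin x. *)
Lemma inv_sqr_bounds x : 0 < x < pi / 2 ->
  (sin x ^+ 2)^-1 - 1 <= (x ^+ 2)^-1 <= (sin x ^+ 2)^-1.
Proof.
move=> /andP[x0 xpi]; have pi0 := pi_gt0 R.
have s0 : 0 < sin x by rewrite sin_gt0_pihalf // x0.
have c0 : 0 < cos x by rewrite cos_gt0_pihalf // xpi andbT; lra.
apply/andP; split.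
  have -> : (sin x ^+ 2)^-1 - 1 = (cos x / sin x) ^+ 2.
    by rewrite expr_div_n cos2sin2 mulrBl divff ?mul1r // expf_neq0 // gt_eqF.
  have h : cos x / sin x <= x^-1.
    rewrite ler_pdivrMr // -(ler_pM2l x0) mulrA divff ?gt_eqF // mul1r.
    by apply: mulr_cos_le_sin; rewrite ltW //=; lra.
  by rewrite -exprVn ler_pXn2r // nnegrE ?divr_ge0 ?invr_ge0 // ltW.
have h : sin x <= x by apply: sin_le_id; exact: ltW.
by rewrite lef_pV2 ?posrE ?exprn_gt0 // ler_pXn2r // nnegrE ltW.
Qed.

Let sin_pihalfB x : sin (pi / 2 - x) = cos x.
Proof. by rewrite sinB sin_pihalf cos_pihalf mul1r mul0r subr0. Qed.

Let cos_pihalfB x : cos (pi / 2 - x) = sin x.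
Proof. by rewrite cosB sin_pihalf cos_pihalf mul1r mul0r add0r. Qed.

(** For k < 2^n, these are the odd multiples of pi / 2^(n+2) in ]0, pi / 2[. Halving them and
    reflecting the halves at pi / 4 produces the angles of level n + 1. *)
Let angle n k : R := (2 * k + 1)%:R * pi / 2 ^+ n.+2.

Let angle_itv n k : (k < 2 ^ n)%N -> 0 < angle n k < pi / 2.
Proof.
move=> kn; have pi0 := pi_gt0 R.
have p0 : 0 < 2 ^+ n.+2 :> R by rewrite exprn_gt0.
rewrite divr_gt0 //=; last by rewrite mulr_gt0 // ltr0n addn1.
have h : (2 * k + 1)%:R < 2 ^+ n.+1 :> R by rewrite -natrX ltr_nat expnS; lia.
rewrite ltr_pdivrMr // exprS (_ : pi / 2 * _ = pi * 2 ^+ n.+1); last by field.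
by rewrite mulrC ltr_pM2l.
Qed.

Let angle_reflect n k : (k < 2 ^ n)%N -> angle n.+1 (2 ^ n.+1 - k.+1) =
  pi / 2 - angle n.+1 k.
Proof.
move=> kn; rewrite /angle.
have kn' : (k.+1 <= 2 ^ n.+1)%N by rewrite expnS; lia.
have -> : (2 * (2 ^ n.+1 - k.+1) + 1)%:R = 2 ^+ n.+2 - (2 * k + 1)%:R :> R.
  rewrite -natrX -natrB; last by rewrite expnS; lia.
  by congr (_%:R); rewrite [in RHS]expnS; lia.
have p0 : 2 ^+ n.+2 != 0 :> R by rewrite expf_neq0 // pnatr_eq0.
by rewrite [2 ^+ n.+3]exprS; field.
Qed.

Let angle_double n k : angle n.+1 k *+ 2 = angle n k.
Proof.
rewrite /angle [2 ^+ n.+3]exprS.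
have p0 : 2 ^+ n.+2 != 0 :> R by rewrite expf_neq0 // pnatr_eq0.
by rewrite -mulr_natr; field.
Qed.

(* By 4 / sin(2 t)^2 = 1 / sin(t)^2 + 1 / sin(pi / 2 - t)^2, each angle splits into
   its half and the complement of its half. *)
Lemma sum_inv_sin_sqr n : \sum_(k < 2 ^ n) (sin (angle n k) ^+ 2)^-1 = 2 * 4 ^+ n.
Proof.
elim: n => [|n IH].
  rewrite expn0 big_ord1 expr0 mulr1 /angle /=.
  have -> : (2 * 0 + 1)%:R * pi / 2 ^+ 2 = pi / 4 :> R by rewrite muln0 add0n
    mul1r; congr (_ / _); ring.
  have h : sin (pi / 4 : R) ^+ 2 = cos (pi / 4) ^+ 2.
    by rewrite -cos_pihalfB; congr (cos _ ^+ 2); field.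
  have := cos2Dsin2 (pi / 4 : R); rewrite -h => {}h.
  have -> : sin (pi / 4 : R) ^+ 2 = 2^-1 by lra.
  by rewrite invrK.
rewrite exprS mulrCA -IH mulr_sumr.
have -> : (2 ^ n.+1 = 2 ^ n + 2 ^ n)%N by rewrite expnS mul2n addnn.
rewrite big_split_ord /= [X in _ + X](reindex_inj rev_ord_inj) /= -big_split /=.
apply: eq_bigr => k _.
have -> : (2 ^ n + (2 ^ n - k.+1) = 2 ^ n.+1 - k.+1)%N.
  by rewrite expnS; have := ltn_ord k; lia.
have kn := ltn_ord k.
rewrite angle_reflect // -(angle_double n k) sin_mulr2n.
set t := angle n.+1 k.
have : 0 < t < pi / 2 by apply: angle_itv; rewrite expnS; lia.
move=> /andP[t0 tpi]; have pi0 := pi_gt0 R.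
have s0 : sin t != 0 by rewrite gt_eqF // sin_gt0_pihalf // t0.
have c0 : cos t != 0 by rewrite gt_eqF // cos_gt0_pihalf // tpi andbT; lra.
rewrite sin_pihalfB -mulr_natr.
rewrite (_ : _ + _ = (cos t ^+ 2 + sin t ^+ 2) / (sin t ^+ 2 * cos t ^+ 2));
  last by field; rewrite s0 c0.
by rewrite cos2Dsin2; field; rewrite s0 c0.
Qed.

(** Sum [inv_sqr_bounds] over the angles of level [n]: the factor pi^2 / (16 4^n) turns their
    inverse squares into those of the odd numbers, and the losses of 1 in the 2^n lower bounds add
    up to 2^n. *)
Lemma sum_inv_odd_sqr_bounds n :
  pi ^+ 2 / 8 - pi ^+ 2 / 16 / 2 ^+ n <=
  \sum_(k < 2 ^ n) ((2 * k + 1)%:R ^+ 2)^-1 <= pi ^+ 2 / 8.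
Proof.
have pi0 := pi_gt0 R.
have p0 : 0 < 2 ^+ n :> R by rewrite exprn_gt0.
have e : \sum_(k < 2 ^ n) ((2 * k + 1)%:R ^+ 2)^-1 =
  pi ^+ 2 / (16 * 4 ^+ n) * \sum_(k < 2 ^ n) (angle n k ^+ 2)^-1.
  rewrite mulr_sumr; apply: eq_bigr => k _.
  have k0 : (2 * k + 1)%:R != 0 :> R by rewrite pnatr_eq0 addn1.
  rewrite /angle 2![2 ^+ _.+1]exprS (_ : 4 = 2 * 2 :> R); last by ring.
  rewrite exprMn; move: (_%:R) k0 (2 ^+ n) p0 (pi) pi0 => r r0 q q0 P P0.
  by field; rewrite r0 !gt_eqF.
have e4 : 4 ^+ n = 2 ^+ n * 2 ^+ n :> R by rewrite -exprMn; congr (_ ^+ _); ring.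
have c0 : 0 < pi ^+ 2 / (16 * 4 ^+ n) :> R by rewrite e4 divr_gt0 ?exprn_gt0
  ?mulr_gt0.
rewrite e; apply/andP; split.
- rewrite (_ : pi ^+ 2 / 8 - _ = pi ^+ 2 / (16 * 4 ^+ n) * (2 * 4 ^+ n - 2 ^+
    n)); last first.
    by rewrite e4; field; rewrite gt_eqF.
  rewrite ler_pM2l // -sum_inv_sin_sqr.
  rewrite -[X in _ - X]natrX -[X in _ - X%:R](card_ord (2 ^ n)) -sumr_const -sumrB.
  by apply: ler_sum => k _; have /andP[] := inv_sqr_bounds (angle_itv (ltn_ord k)).
- rewrite (_ : pi ^+ 2 / 8 = pi ^+ 2 / (16 * 4 ^+ n) * (2 * 4 ^+ n)); last first.
    by rewrite e4; field; rewrite gt_eqF.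
  rewrite ler_pM2l // -sum_inv_sin_sqr.
  by apply: ler_sum => k _; have /andP[] := inv_sqr_bounds (angle_itv (ltn_ord k)).
Qed.

Let inv_sqr_sum n : R := \sum_(k < n) (k.+1%:R ^+ 2)^-1.

Let inv_sqr_sum_double n :
  inv_sqr_sum (2 * n) = \sum_(k < n) ((2 * k + 1)%:R ^+ 2)^-1 + inv_sqr_sum n / 4.
Proof.
elim: n => [|n IH]; first by rewrite muln0 /inv_sqr_sum !big_ord0 mul0r addr0.
rewrite /inv_sqr_sum (_ : 2 * n.+1 = (2 * n).+2)%N; last by lia.
rewrite 2!big_ord_recr /= -/(inv_sqr_sum (2 * n)) IH [in RHS]big_ord_recr /=.
rewrite [X in _ = _ + X / 4]big_ord_recr /= -/(inv_sqr_sum n) addn1.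
have -> : ((2 * n).+2%:R ^+ 2)^-1 = (n.+1%:R ^+ 2)^-1 / 4 :> R.
  have n0 : n.+1%:R != 0 :> R by rewrite pnatr_eq0.
  by rewrite (_ : (2 * n).+2 = 2 * n.+1)%N ?natrM; [field|lia].
ring.
Qed.

Let inv_sqr_sum_homo : {homo inv_sqr_sum : m n / (m <= n)%N >-> m <= n}.
Proof.
apply: homo_leq => [x|y x z|n]; [exact: lexx|exact: le_trans|].
by rewrite /inv_sqr_sum big_ord_recr /= lerDl invr_ge0 exprn_ge0.
Qed.

(** A crude bound that makes the nondecreasing partial sums converge: doubling the range gives at
    most pi^2 / 8 plus a quarter of the previous sum. *)
Let inv_sqr_sum_pow2_le n : inv_sqr_sum (2 ^ n) <= pi ^+ 2.
Proof.
have p2 : 1 <= pi ^+ 2.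
  by apply: exprn_ege1; have := pihalf_ge1 R; lra.
elim: n => [|n IH]; first by rewrite /inv_sqr_sum big_ord1 expr1n invr1.
rewrite expnS inv_sqr_sum_double.
by have /andP[_] := sum_inv_odd_sqr_bounds n; lra.
Qed.

Lemma cvg_sum_inv_sqr : \sum_(k < n) (k.+1%:R ^+ 2)^-1 @[n --> \oo] --> pi ^+ 2 / 6.
Proof.
have cvS : cvgn inv_sqr_sum.
  apply: nondecreasing_is_cvgn => //.
  exists (pi ^+ 2) => _ [n _ <-]; apply: le_trans (inv_sqr_sum_pow2_le n).
  by apply: inv_sqr_sum_homo; apply: ltnW; exact: ltn_expl.
have cvpow : (fun n => 2 ^ n)%N @ \oo --> \oo.
  apply/cvgnyPge => K; near=> n.
  apply: (@leq_trans n); last by apply: ltnW; exact: ltn_expl.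
  by near: n; exact: nbhs_infty_ge.
have cvl : inv_sqr_sum (2 ^ n) @[n --> \oo] --> limn inv_sqr_sum.
  exact: (cvg_comp _ _ cvpow cvS).
have cvl' : inv_sqr_sum (2 ^ n.+1) @[n --> \oo] --> limn inv_sqr_sum.
  exact: (cvg_comp _ _ (cvg_comp _ _ (cvg_addnl 1) cvpow) cvS).
have cvodd : \sum_(k < 2 ^ n) ((2 * k + 1)%:R ^+ 2)^-1 @[n --> \oo] --> pi ^+ 2 / 8.
  apply: (squeeze_cvgr (f := fun n => pi ^+ 2 / 8 - pi ^+ 2 / 16 / 2 ^+ n)
    (h := fun=> pi ^+ 2 / 8)).
  - by apply: nearW => n; exact: sum_inv_odd_sqr_bounds.
  - rewrite -[X in _ --> X]subr0; apply: cvgB; first exact: cvg_cst.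
    rewrite -[X in _ --> X](mulr0 (pi ^+ 2 / 16)); apply: cvgMl_tmp.
    under eq_fun do rewrite -exprVn; apply: cvg_expr.
    by rewrite ger0_norm ?invf_lt1 // ltr1n.
  - exact: cvg_cst.
(* Separating odd and even terms shows that the limit L satisfies L = pi^2 / 8 + L / 4. *)
have : inv_sqr_sum (2 ^ n.+1) @[n --> \oo] --> pi ^+ 2 / 8 + limn inv_sqr_sum / 4.
  under eq_fun do rewrite expnS inv_sqr_sum_double.
  by apply: cvgD => //; exact: cvgMr_tmp.
move=> /(cvg_unique _ cvl') => /(_ (@norm_hausdorff _ _)) e.
suff -> : pi ^+ 2 / 6 = limn inv_sqr_sum by exact: cvS.
lra.
Unshelve. all: end_near. Qed.

Lemma nneseries_inv_sqr :
  (\sum_(n <oo) (2 / n.+1%:R ^+ 2)%:E = (pi ^+ 2 / 3)%:E)%E.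
Proof.
apply: cvg_lim => //.
rewrite (_ : (fun _ => _) = EFin \o (fun n => 2 * \sum_(k < n) (k.+1%:R ^+ 2)^-1)).
  apply: cvg_EFin; first exact: nearW.
  rewrite (_ : pi ^+ 2 / 3 = 2 * (pi ^+ 2 / 6)); last by field.
  by apply: cvgMl_tmp; exact: cvg_sum_inv_sqr.
apply/funext => n /=; rewrite sumEFin big_mkord mulr_sumr.
by congr EFin; apply: eq_bigr.
Qed.

End Basel.

(** * Symmetry and divergence of moments *)

Section MomentSymmetryDivergence.
Variable R : realType.
Implicit Types (a b : {ffun 'I_3 -> nat}) (i j k : 'I_3) (n : nat).

Lemma subhatK a j : (0 < a j)%N -> (a :- j) :+ j = a.
Proof.
move=> aj; apply/ffunP => i; rewrite !ffunE subnK //.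
by have [->|] := eqVneq i j.
Qed.

Lemma sum_addhat a j : (\sum_i (a :+ j) i = (\sum_i a i).+1)%N.
Proof.
under eq_bigr do rewrite ffunE; rewrite big_split /= [X in
  (_ + X)%N](bigD1 j) //= eqxx [X in (_ + (_ + X))%N]big1 ?addn1 //.
by move=> i /negbTE ->.
Qed.

Lemma moment_dirichlet a :
  moment R a [ffun=> 0%N] = (2 * ((\prod_j (a j)`!)%:R / (\sum_j a j + 2)`!%:R))%:E.
Proof.
rewrite moment_fact ?ffunE // subn0 natr_prod prod_I3 subn0; congr (_ * _)%:E.
have : (a i0 + a i1 + 1)`!%:R != 0 :> R by rewrite pnatr_eq0 -lt0n fact_gt0.
by move=> x0; rewrite [X in _ / X]mulrC -mulf_div divff // mulr1.
Qed.

(** Induction on the sum of [b]: the series lowers an entry of [b] and its image under the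
    permutation, at the price of shifting [a]. For b = 0 the value is the symmetric Dirichlet
    formula. *)
Lemma moment_perm (s : {perm 'I_3}) a b :
  moment R [ffun j => a (s j)] [ffun j => b (s j)] = moment R a b.
Proof.
have [n] := ubnP (\sum_j b j)%N; elim: n a b => // n IH a b bn.
have [/existsP[j bj]|/existsPn b0] := boolP [exists j, (0 < b j)%N]; last first.
  have -> : [ffun j => b (s j)] = [ffun=> 0%N].
    by apply/ffunP => j; rewrite !ffunE; apply/eqP; rewrite -leqn0 leqNgt.
  have -> : b = [ffun=> 0%N].
    by apply/ffunP => j; rewrite !ffunE; apply/eqP; rewrite -leqn0 leqNgt.
  rewrite !moment_dirichlet; congr (_ * (_%:R / (_ + _)`!%:R))%:E.
  - by rewrite [RHS](reindex_inj (@perm_inj _ s)); apply: eq_bigr => j _;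
      rewrite ffunE.
  - by rewrite [RHS](reindex_inj (@perm_inj _ s)); apply: eq_bigr => j _;
      rewrite ffunE.
rewrite -(subhatK bj); set b' := b :- j.
have -> : [ffun i => (b' :+ j) (s i)] = [ffun i => b' (s i)] :+ (s^-1)%g j.
  apply/ffunP => i; rewrite !ffunE; congr (_ + nat_of_bool _)%N.
  by apply/eqP/eqP => [<-|->]; rewrite ?permK ?permKV.
rewrite !moment_series; apply: eq_eseriesr => m _.
rewrite -(IH (addhatn a j m) b'); last first.
  by rewrite -ltnS -(sum_addhat b' j) subhatK // (leq_trans bn).
congr (moment R _ _); apply/ffunP => i; rewrite !ffunE;
  congr (_ + _ * nat_of_bool _)%N.
by apply/eqP/eqP => [->|<-]; rewrite ?permK ?permKV.
Qed.

Lemma moment_le_addhatn a b j n : (moment R a b <= moment R a (addhatn b j n))%E.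
Proof.
elim: n => [|n IH].
  by rewrite (_ : addhatn b j 0 = b) //; apply/ffunP => i; rewrite ffunE addn0.
rewrite (_ : addhatn b j n.+1 = addhatn b j n :+ j); last first.
  by apply/ffunP => i; rewrite !ffunE mulSn -addnA [(_ * _ + _)%N]addnC.
by rewrite moment_addhatr (le_trans IH) // leeDl // moment_ge0.
Qed.

Lemma nneseries_harmonic : (\sum_(n <oo) (n.+1%:R^-1 : R)%:E = +oo)%E.
Proof.
apply: cvg_lim => //.
rewrite (_ : (fun _ => _) = EFin \o series (@harmonic R)); last first.
  by apply/funext => n /=; rewrite /series /= sumEFin.
apply/cvgeryP/nondecreasing_dvgn_lt; last exact: dvg_harmonic.
by apply: nondecreasing_series => n _ _; rewrite harmonic_ge0.
Qed.

Lemma moment_pinfty a b j : (\sum_i a i + 1 < a j + b j)%N -> moment R a b = +oo%E.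
Proof.
have base a' b' : (\sum_i a' i + 1 < a' i2 + b' i2)%N -> moment R a' b' = +oo%E.
  rewrite sumn_I3 => h.
  (* The least divergent exponent at [i2] is [c + 1]. There, with zeros elsewhere, [moment_fact]
     turns the n-th term of the series into a constant over a_2 + n + 1; the inequality a_2 + n + 1
     <= (a_2 + 1)(n + 1) gives the constant [K] in the comparison with the harmonic series. *)
  pose c := (a' i0 + a' i1 + 1)%N.
  pose d : {ffun 'I_3 -> nat} := [ffun i => (c * (i == i2))%N].
  have : moment R a' (d :+ i2) = +oo%E.
    apply/eqP; rewrite -leye_eq moment_series.
    pose K : R := 2 * ((a' i0)`!%:R * (a' i1)`!%:R / c`!%:R) / (a' i2).+1%:R.
    have K0 : 0 < K by rewrite !(mulr_gt0, invr_gt0, ltr0n, fact_gt0).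
    rewrite -[leLHS](@gt0_muley _ K%:E) ?lte_fin //.
    rewrite -nneseries_harmonic -nneseriesZl; last by move=> n _; rewrite lee_fin.
    apply: lee_nneseries => n _; first by rewrite -EFinM lee_fin mulr_ge0 // ltW.
    rewrite moment_fact ?ffunE //= ?muln1 ?muln0 ?addn0 //.
    rewrite -EFinM lee_fin -/c subnn fact0 mulr1 sumn_I3 !ffunE /= !muln0 muln1
      !addn0.
    have -> : (a' i0 + a' i1 + (a' i2 + n) + 2 - c =
      (a' i2 + n).+1)%N by rewrite /c; lia.
    rewrite factS natrM.
    set f := (a' i2 + n)`!%:R; have f0 : 0 < f by rewrite /f ltr0n fact_gt0.
    have c0 : 0 < c`!%:R :> R by rewrite ltr0n fact_gt0.
    rewrite (_ : 2 * _ = 2 * ((a' i0)`!%:R * (a' i1)`!%:R / c`!%:R) / (a' i2 +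
      n).+1%:R); last first.
      by field; rewrite !gt_eqF // ltr0n.
    rewrite /K -[leLHS]mulrA ler_pM2l; last by rewrite !(mulr_gt0, invr_gt0,
      ltr0n, fact_gt0).
    rewrite -invfM lef_pV2 ?posrE ?mulr_gt0 ?ltr0n // -natrM ler_nat; lia.
  move=> Moo; apply/eqP; rewrite -leye_eq -Moo.
  (* [b'] dominates this exponent entrywise, and moments grow with [b]. *)
  have -> : b' = addhatn (addhatn (addhatn (d :+ i2) i0 (b' i0)) i1 (b' i1)) i2
    (b' i2 - c.+1).
    apply/ffunP; apply: I3P; rewrite !ffunE /=; rewrite /c in h *; lia.
  by do 3 (apply: le_trans (moment_le_addhatn _ _ _ _)).
move=> h; rewrite -(moment_perm (tperm j i2)); apply: base; rewrite !ffunE tpermR.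
apply: leq_ltn_trans h; rewrite leq_add2r.
rewrite [X in (_ <= X)%N](reindex_inj (@perm_inj _ (tperm j i2))) /=.
by apply: eq_leq; apply: eq_bigr => i _; rewrite ffunE.
Qed.

End MomentSymmetryDivergence.

(** * Moments with both exponents 0 at one vertex: closed forms and recurrences *)

Section EdgeMoment.
Variable R : realType.

Definition triple (x y z : nat) : {ffun 'I_3 -> nat} :=
  [ffun j => nth 0%N [:: x; y; z] (val j)].

Lemma triple_eta (a : {ffun 'I_3 -> nat}) : triple (a i0) (a i1) (a i2) = a.
Proof. by apply/ffunP; apply: I3P; rewrite ffunE. Qed.

Definition edge_moment a1 a2 b1 b2 : \bar R := moment R (triple 0 a1 a2) (triple
  0 b1 b2).
Notation J := edge_moment.

(** Euler's beta function at (k + 1, n + 1). *)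
Definition beta_fact k n : R := (k`! * n`!)%:R / (k + n + 1)`!%:R.

Lemma beta_factC k n : beta_fact k n = beta_fact n k.
Proof. by rewrite /beta_fact mulnC [in X in _ / X]addnAC [in X in
  _ / X]addnC addnA. Qed.

Lemma edge_moment_ge0 a1 a2 b1 b2 : (0 <= J a1 a2 b1 b2)%E.
Proof. exact: moment_ge0. Qed.

Lemma edge_momentC a1 a2 b1 b2 : J a1 a2 b1 b2 = J a2 a1 b2 b1.
Proof.
rewrite /J -(moment_perm R (tperm i1 i2)).
by congr moment; apply/ffunP; apply: I3P; rewrite !ffunE ?tpermL ?tpermR ?tpermD.
Qed.

Lemma edge_moment0 a1 a2 b2 : (b2 <= a1 + 1)%N ->
  J a1 a2 0 b2 = (2 / (a1 + 1)%:R * beta_fact a2 (a1 + 1 - b2))%:E.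
Proof.
move=> h; rewrite /J moment_fact ?sumn_I3 ?ffunE //= add0n; congr EFin.
rewrite /beta_fact (_ : a1 + a2 + 2 - b2 = a2 + (a1 + 1 - b2) + 1)%N; last by lia.
rewrite fact0 mul1r addn1 factS natrM (natrM _ a2`!).
have f1 : a1`!%:R != 0 :> R by rewrite pnatr_eq0 -lt0n fact_gt0.
have f2 : (a2 + (a1.+1 - b2) + 1)`!%:R != 0 :> R by rewrite pnatr_eq0 -lt0n
  fact_gt0.
move: f1 f2; move: (_`!%:R) => x; move: ((_ + 1)`!%:R) => z; move: (a2`!%:R) => u.
move: ((_ - _)`!%:R) => w x0 z0.
have a0 : a1.+1%:R != 0 :> R by rewrite pnatr_eq0.
by move: (a1.+1%:R) a0 => y y0; field; rewrite x0 y0 z0.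
Qed.

Lemma edge_moment_series1 a1 a2 b1 b2 :
  (J a1 a2 b1.+1 b2 = \sum_(n <oo) J (a1 + n) a2 b1 b2)%E.
Proof.
rewrite /J (_ : triple 0 b1.+1 b2 = triple 0 b1 b2 :+ i1); last first.
  by apply/ffunP; apply: I3P; rewrite !ffunE //= ?addn1 ?addn0.
rewrite moment_series; apply: eq_eseriesr => n _; congr moment.
by apply/ffunP; apply: I3P; rewrite !ffunE //= ?muln0 ?muln1 ?addn0.
Qed.

Lemma edge_moment_series2 a1 a2 b1 b2 :
  (J a1 a2 b1 b2.+1 = \sum_(n <oo) J a1 (a2 + n) b1 b2)%E.
Proof.
rewrite edge_momentC edge_moment_series1.
by apply: eq_eseriesr => n _; rewrite edge_momentC.
Qed.

Lemma edge_moment_add1 a1 a2 b1 b2 :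
  (J a1 a2 b1.+1 b2 = J a1 a2 b1 b2 + J a1.+1 a2 b1.+1 b2)%E.
Proof.
rewrite /J (_ : triple 0 b1.+1 b2 = triple 0 b1 b2 :+ i1); last first.
  by apply/ffunP; apply: I3P; rewrite !ffunE //= ?addn1 ?addn0.
rewrite moment_addhatr; congr (_ + moment _ _ _)%E.
by apply/ffunP; apply: I3P; rewrite !ffunE //= ?addn1 ?addn0.
Qed.

Lemma beta_fact_ge0 k n : 0 <= beta_fact k n.
Proof. by rewrite divr_ge0. Qed.

(** This is the series for 1 / (1 - lambda_2) applied to moments whose remaining denominator is
    trivial: up to the factor 2 / (k + 1), both sides are closed forms of such moments. *)
Lemma nneseries_beta_fact k n :
  (\sum_(m <oo) (beta_fact k.+1 (n + m))%:E = (beta_fact k n)%:E)%E.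
Proof.
have := edge_moment_series2 k n 0 0; rewrite edge_moment0 ?addn1 //.
under eq_eseriesr do rewrite edge_moment0 // subn0 EFinM addn1.
rewrite nneseriesZl; last by move=> m _; rewrite lee_fin beta_fact_ge0.
rewrite EFinM subSS subn0 => /esym/(congr1 (fun x => ((k.+1%:R / 2)%:E * x)%E)).
have k0 : k.+1%:R != 0 :> R by rewrite pnatr_eq0.
have e : k.+1%:R / 2 * (2 / k.+1%:R) = 1 :> R by field.
rewrite !muleA -!EFinM e !mul1e mul1r (beta_factC k n) => <-.
by apply: eq_eseriesr => m _; rewrite beta_factC.
Qed.

(* The coefficients do not depend on a1, which is all that the series for
   1 / (1 - lambda_1) shifts: the identity propagates from b1 to b1 + 1. *)
Lemma edge_moment_by_parts a1 a2 b1 c : (0 < c)%N -> (c <= a1)%N -> (b1 <= a2 +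
  1)%N ->
  (c%:R%:E * J a1 a2 b1 c.+1 + (a2 + 1)%:R%:E * J a1 a2 b1 c =
   c%:R%:E * J a1 a2 b1 c + (2 * beta_fact (a2 + 1 - b1) (a1 - c))%:E)%E.
Proof.
move=> c0; elim: b1 a1 => [|b1 IH] a1 ca ba.
  rewrite !edge_moment0; [|lia|lia]; rewrite -!EFinM -!EFinD; congr EFin.
  rewrite subn0 /beta_fact.
  rewrite (_ : a1 + 1 - c = (a1 - c).+1)%N; last by lia.
  rewrite (_ : a1 + 1 - c.+1 = a1 - c)%N; last by lia.
  have [d ->] : exists d, a1 = (c + d)%N by exists (a1 - c)%N; lia.
  rewrite addKn.
  rewrite (_ : a2 + d.+1 + 1 = (a2 + d + 1).+1)%N; last by lia.
  rewrite (_ : a2 + 1 + d + 1 = (a2 + d + 1).+1)%N; last by lia.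
  rewrite (_ : (a2 + 1)`! = a2.+1 * a2`!)%N; last by rewrite addn1 factS.
  rewrite !factS !natrM.
  have f : (a2 + d + 1)`!%:R != 0 :> R by rewrite pnatr_eq0 -lt0n fact_gt0.
  move: f (a2`!%:R) (d`!%:R); move: (_`!%:R) => x x0 u w.
  rewrite -!natr1 !natrD.
  have := ler0n R c; have := ler0n R d; have := ler0n R a2.
  move: (c%:R) (d%:R) (a2%:R) => C D A A0 D0 C0.
  by field; rewrite x0 /= !gt_eqF //; lra.
have J0 := edge_moment_ge0.
rewrite !(edge_moment_series1 a1) -!nneseriesZl //.
(* The term for [b1 + 1] is the sum of the shifted terms for [b1]: as [b1 < a2 + 1], the index
   [a2 + 1 - b1] is a successor and [nneseries_beta_fact] applies. *)
rewrite (_ : 2 * beta_fact (a2 + 1 - b1.+1) (a1 - c) =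
  2 * beta_fact (a2 + 1 - b1).-1 (a1 - c)); last first.
  by congr (2 * beta_fact _ _); lia.
rewrite EFinM -nneseries_beta_fact -nneseriesZl; last by move=> n _;
  rewrite lee_fin beta_fact_ge0.
rewrite -!nneseriesD; try by [move=> n _ _; rewrite mule_ge0 // lee_fin|
  move=> n _ _; rewrite -EFinM lee_fin mulr_ge0 // beta_fact_ge0].
apply: eq_eseriesr => n _; rewrite IH; [|lia|lia].
congr (_ + _)%E; rewrite -EFinM; congr (_ * beta_fact _ _)%:E; lia.
Qed.

Lemma edge_moment11_0 : J 0 0 1 1 = (pi ^+ 2 / 3)%:E.
Proof.
rewrite edge_moment_series1 -nneseries_inv_sqr; apply: eq_eseriesr => n _.
rewrite add0n edge_moment0 ?addn1 // subSS subn0 /beta_fact; congr EFin.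
rewrite fact0 mul1n add0n addn1 factS natrM.
have f : n`!%:R != 0 :> R by rewrite pnatr_eq0 -lt0n fact_gt0.
have n0 : n.+1%:R != 0 :> R by rewrite pnatr_eq0.
by move: (n.+1%:R) n0 => y y0; field; rewrite f y0.
Qed.

Lemma edge_moment11_step a1 a2 (x : R) : J a1 a2 1 1 = x%:E ->
  J a1.+1 a2 1 1 = (x - 2 / a1.+1%:R * beta_fact a2 a1)%:E.
Proof.
move=> Jx; have := edge_moment_add1 a1 a2 0 1;
  rewrite Jx edge_moment0 ?addnK ?addn1 //.
have := edge_moment_ge0 a1.+1 a2 1 1; case: (J _ _ _ _) => // y _.
by rewrite -EFinD => -[->]; congr EFin; rewrite ?subn1 /= [RHS]addrC addKr.
Qed.

(** Start at a1 = a2 = 0 and raise first [a2], by symmetry, then [a1]. Each step subtracts one beta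
    value, which is 2 / i^2 along the first leg; the two legs give the two sums. *)
Lemma edge_moment11 a1 a2 : J a1 a2 1 1 =
  (- 2 * (\sum_(1 <= i < a2.+1) 1 / i%:R ^+ 2) + pi ^+ 2 / 3
   - 2 * (\sum_(1 <= j < a1.+1)
            1 / j%:R * ((a2`! * (j - 1)`!)%:R / (a2 + j)`!%:R)))%:E.
Proof.
elim: a1 => [|a1 IH].
  rewrite [X in _ - 2 * X]big_geq // mulr0 subr0.
  elim: a2 => [|a2 IH]; first by rewrite big_geq // mulr0 add0r edge_moment11_0.
  move: IH; rewrite edge_momentC => /edge_moment11_step; rewrite edge_momentC => ->.
  rewrite [in RHS]big_nat_recr //=; congr EFin.
  rewrite /beta_fact fact0 mul1n add0n addn1 factS natrM.
  have f : a2`!%:R != 0 :> R by rewrite pnatr_eq0 -lt0n fact_gt0.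
  have n0 : a2.+1%:R != 0 :> R by rewrite pnatr_eq0.
  by move: (a2.+1%:R) n0 => y y0; field; rewrite f y0.
rewrite (edge_moment11_step IH) [X in _ = (_ - 2 * X)%:E]big_nat_recr //=;
  congr EFin.
rewrite /beta_fact subn1 /= addn1 addnS.
rewrite -[LHS]addrA -opprD; congr (_ - _).
by rewrite [in RHS]mulrDr; congr (_ + _); rewrite !mulrA mulr1.
Qed.

(** [edge_moment_by_parts] solved for its first moment. Finiteness comes with it: an infinite value
    there would make only one side of that identity infinite. *)
Lemma edge_moment_rec a1 a2 b1 c (x : R) : (0 < c)%N -> (c <= a1)%N -> (b1 <= a2
  + 1)%N ->
  J a1 a2 b1 c = x%:E ->
  J a1 a2 b1 c.+1 = ((c%:R - a2%:R - 1) / c%:R * x +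
                     2 / c%:R * beta_fact (a2 + 1 - b1) (a1 - c))%:E.
Proof.
move=> c0 ca ba Jx; have := edge_moment_by_parts c0 ca ba; rewrite Jx.
have cR : 0 < c%:R :> R by rewrite ltr0n.
have := edge_moment_ge0 a1 a2 b1 c.+1; case: (J _ _ _ _) => // [y _|_].
  rewrite -!EFinM -!EFinD => -[e]; congr EFin.
  apply: (mulfI (lt0r_neq0 cR)).
  transitivity (c%:R * x + 2 * beta_fact (a2 + 1 - b1) (a1 - c) - (a2 + 1)%:R * x).
    by rewrite -e addrK.
  by rewrite natrD; field; rewrite gt_eqF.
by rewrite gt0_muley ?lte_fin.
Qed.

Lemma edge_moment_pinfty a1 a2 b1 b2 :
  (maxn (a1 + b1) (a2 + b2) > a1 + a2 + 1)%N -> J a1 a2 b1 b2 = +oo%E.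
Proof.
rewrite leq_max => /orP[] h.
- by apply: (@moment_pinfty _ _ _ i1); rewrite sumn_I3 !ffunE.
- by apply: (@moment_pinfty _ _ _ i2); rewrite sumn_I3 !ffunE.
Qed.

End EdgeMoment.

(** * Correctness of [ComputeJ] *)

Section ComputeJCorrect.
Variable R : realType.
Notation J := (@edge_moment R).

Definition ComputeJ_sorted (a1 a2 b1 b2 : nat) : prog R :=
  if b1 == 0%N then
    Ret (2 / (a1 + 1)%:R *
         ((a2`! * (a1 + 1 - b2)`!)%:R / (a1 + a2 + 2 - b2)`!%:R))%:E
  else if (b1 == 1%N) && (b2 == 1%N) then
    Ret (- 2 * (\sum_(1 <= i < a2.+1) 1 / i%:R ^+ 2) + pi ^+ 2 / 3
         - 2 * (\sum_(1 <= j < a1.+1)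
                  1 / j%:R * ((a2`! * (j - 1)`!)%:R / (a2 + j)`!%:R)))%:E
  else if (b1 == 1%N) && (b2 > 1)%N then
    CallJ a1 a2 1 (b2 - 1) (fun r =>
    Ret (((b2%:R - a2%:R - 2) / (b2%:R - 1))%:E * r +
         (2 / (b2%:R - 1) *
          (((a1 + 1 - b2)`! * a2`!)%:R / (a1 + a2 + 2 - b2)`!%:R))%:E)%E)
  else
    CallJ a1 a2 (b1 - 1) b2 (fun r =>
    Ret (((b1%:R - a1%:R - 2) / (b1%:R - 1))%:E * r +
         (2 / (b1%:R - 1) *
          (((a2 + 1 - b1)`! * (a1 + 1 - b2)`!)%:R /
           (a2 + a1 + 3 - b1 - b2)`!%:R))%:E)%E).

(** The negation of the test for +oo in [ComputeJ], with the common summands cancelled. *)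
Definition edge_valid (a1 a2 b1 b2 : nat) := (b1 <= a2 + 1)%N && (b2 <= a1 + 1)%N.

Lemma returns_ComputeJ_sorted a1 a2 b1 b2 :
  (forall c1 c2, (c1 + c2 < b1 + b2)%N ->
     returns (ComputeJ R a1 a2 c1 c2) (J a1 a2 c1 c2) /\
     (edge_valid a1 a2 c1 c2 -> J a1 a2 c1 c2 \is a fin_num)) ->
  edge_valid a1 a2 b1 b2 -> (b1 <= b2)%N ->
  returns (ComputeJ_sorted a1 a2 b1 b2) (J a1 a2 b1 b2) /\ J a1 a2 b1 b2 \is a
    fin_num.
Proof.
move=> IH /andP[v1 v2] b12; rewrite /ComputeJ_sorted.
case: ifPn => [/eqP b10|b1n0].
  rewrite b10 edge_moment0 //; split => //.
  rewrite /beta_fact (_ : a2 + (a1 + 1 - b2) + 1 = a1 + a2 + 2 - b2)%N; last by lia.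
  exact: returns_Ret.
case: ifPn => [/andP[/eqP -> /eqP ->]|].
  by rewrite edge_moment11; split => //; exact: returns_Ret.
rewrite negb_and => n11; case: ifPn => [/andP[/eqP b11 b2gt]|n1].
  have [c ec] : exists c, b2 = c.+1 by exists b2.-1; lia.
  have [|ret fin] := IH 1%N c; [lia|].
  have vc : edge_valid a1 a2 1 c by apply/andP; split; lia.
  have /fineK/esym Jx := fin vc; set x := fine _ in Jx.
  subst b1 b2; rewrite (edge_moment_rec _ _ _ Jx); [|lia|lia|lia].
  split=> //; rewrite subSS subn0.
  apply: returns_CallJ ret _; rewrite Jx -EFinM -EFinD.
  have -> : c.+1%:R - 1 = c%:R :> R by rewrite -natr1 addrK.
  have -> : c.+1%:R - a2%:R - 2 = c%:R - a2%:R - 1 :> R by rewrite -natr1; ring.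
  rewrite addnK beta_factC /beta_fact.
  rewrite (_ : a1 + 1 - c.+1 = a1 - c)%N; last by lia.
  rewrite (_ : a1 + a2 + 2 - c.+1 = a1 - c + a2 + 1)%N; last by lia.
  exact: returns_Ret.
have [c ec] : exists c, b1 = c.+1 by exists b1.-1; lia.
have c0 : (0 < c)%N by move: n11 n1; rewrite ec; case: c {ec} => //=; lia.
have [|ret fin] := IH c b2; [lia|].
have vc : edge_valid a1 a2 c b2 by apply/andP; split; lia.
have /fineK/esym Jx := fin vc; set x := fine _ in Jx.
(* [edge_moment_rec] raises the last exponent, whereas this call lowered [b1]; the two vertices are
   exchanged. *)
subst b1; have Jx' : J a2 a1 b2 c = x%:E by rewrite edge_momentC.
rewrite edge_momentC (edge_moment_rec _ _ _ Jx'); [|lia|lia|lia].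
split=> //; rewrite subSS subn0.
apply: returns_CallJ ret _; rewrite Jx -EFinM -EFinD.
have -> : c.+1%:R - 1 = c%:R :> R by rewrite -natr1 addrK.
have -> : c.+1%:R - a1%:R - 2 = c%:R - a1%:R - 1 :> R by rewrite -natr1; ring.
rewrite beta_factC /beta_fact.
rewrite (_ : a2 + 1 - c.+1 = a2 - c)%N; last by lia.
rewrite (_ : a2 + a1 + 3 - c.+1 - b2 = a2 - c + (a1 + 1 - b2) + 1)%N; last by lia.
exact: returns_Ret.
Qed.

Lemma perm_eq_pair (T : eqType) (t : 2.-tuple T) (x y : T) :
  perm_eq t [:: x; y] -> t = [tuple x; y] \/ t = [tuple y; x].
Proof.
case: t => [[|u [|w [|//]]] h] //= p.
have := perm_mem p u; have := p; rewrite !inE eqxx /= => {}p /esym/orP[]/eqP e;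
  subst u.
- move: p; rewrite perm_cons => /perm_small_eq /= e; left; apply/val_inj => /=.
  by rewrite e.
- have : perm_eq [:: y; w] [:: y; x].
    by rewrite (perm_trans p) // -[[:: x; y]]/([:: x] ++ [:: y]) perm_catC.
  rewrite perm_cons => /perm_small_eq /= e.
  by right; apply/val_inj => /=; rewrite e.
Qed.

Lemma returns_ComputeJ a1 a2 b1 b2 :
  returns (ComputeJ R a1 a2 b1 b2) (J a1 a2 b1 b2) /\
  (edge_valid a1 a2 b1 b2 -> J a1 a2 b1 b2 \is a fin_num).
Proof.
have [n] := ubnP (b1 + b2)%N; elim: n a1 a2 b1 b2 => // n IHn a1 a2 b1 b2 bn.
have IH c1 c2 d1 d2 : (d1 + d2 < b1 + b2)%N -> _ :=
  fun h => IHn c1 c2 d1 d2 (leq_trans h bn).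
rewrite /ComputeJ; case: ifPn => [inv|].
  rewrite edge_moment_pinfty //; split; first exact: returns_Ret.
  by move: inv; rewrite leq_max /edge_valid => /orP[] ? /andP[? ?]; lia.
rewrite -leqNgt geq_max => /andP[h1 h2].
have v : edge_valid a1 a2 b1 b2 by apply/andP; split; lia.
have v' : edge_valid a2 a1 b2 b1 by apply/andP; split; lia.
have IH' c1 c2 : (c1 + c2 < b2 + b1)%N -> _ := fun h =>
  IH a2 a1 c1 c2 (leq_trans h (eq_leq (addnC _ _))).
split; last first.
  move=> _; case/orP: (leq_total b1 b2) => b12.
    by have [] := returns_ComputeJ_sorted (IH a1 a2) v b12.
  by rewrite edge_momentC; have [] := returns_ComputeJ_sorted IH' v' b12.
apply: returns_Sort => t pt st.
(* If [b1 = b2], both orders are sorted and both have to return the same value. *)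
have [tE|tE] := perm_eq_pair pt; rewrite tE /= andbT in st *.
  exact: (returns_ComputeJ_sorted (IH a1 a2) v st).1.
rewrite edge_momentC; exact: (returns_ComputeJ_sorted IH' v' st).1.
Qed.

End ComputeJCorrect.

(** * Correctness of [ComputeI] *)

Section ComputeICorrect.
Variable R : realType.
Implicit Types (a b : {ffun 'I_3 -> nat}).
Notation M := (@moment R).

Definition ComputeI_sorted (sz : nat) a b : prog R :=
  if (b i0 == 0%N) && (b i1 == 0%N) then
    Ret (2 * (((a i0)`! * (a i1)`! * (a i2)`!)%:R / (sz + 2 - b i2)`!%:R) *
         ((a i0 + a i1 + 1 - b i2)`!%:R / (a i0 + a i1 + 1)`!%:R))%:E
  else if (b i0 >= 1)%N then
    CallI a (b :- i0) (fun r0 =>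
    CallI a (b :- i1) (fun r1 =>
    CallI a (b :- i2) (fun r2 =>
    Ret ((1 / 2)%:E * (r0 + r1 + r2))%E)))
  else if a i0 == 0%N then
    CallJ (a i1) (a i2) (b i1) (b i2) Ret
  else if (a i1 + b i1 < sz + 1)%N then
    CallI (a :- i0) (b :- i2) (fun r =>
    CallI (a :- i0 :+ i1) b (fun r' =>
    Ret (r - r')%E))
  else if (a i2 + b i2 < sz + 1)%N then
    CallI (a :- i0) (b :- i1) (fun r =>
    CallI (a :- i0 :+ i2) b (fun r' =>
    Ret (r - r')%E))
  else
    CallI a (b :- i1) (fun r1 =>
    CallI (a :- i0 :+ i1) (b :- i1) (fun r1' =>
    CallI a (b :- i2) (fun r2 =>
    CallI (a :- i0 :+ i2) (b :- i2) (fun r2' =>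
    CallI (a :- i0 :+ i1 :+ i2) b (fun r =>
    Ret ((1 / 2)%:E * ((r1 + r1') + (r2 + r2')) - r)%E))))).

Definition valid a b : Prop := forall j, (a j + b j <= \sum_i a i + 1)%N.

(* ComputeI terminates since (|b|, free_degree a b) decreases lexicographically:
   the calls that keep b lower a at i0, the only zero of b at that stage. *)
Definition free_degree a b : nat := (\sum_j if b j == 0%N then a j else 0)%N.

Definition correct a b : Prop :=
  returns (ComputeI R a b) (M a b) /\ (valid a b -> M a b \is a fin_num).

Let sub_of_add (x y z : \bar R) : x \is a fin_num -> z \is a fin_num ->
  x = (y + z)%E -> y \is a fin_num /\ (x - z)%E = y.
Proof.
move=> fx fz e; have : (y + z)%E \is a fin_num by rewrite -e.
by rewrite fin_numD => /andP[fy _]; split => //; rewrite e addeK.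
Qed.

Let half_double (x : \bar R) : x \is a fin_num -> ((1 / 2)%:E * (x + x))%E = x.
Proof. by move=> /fineK <-; rewrite -EFinD -EFinM; congr EFin; field. Qed.

Lemma returns_ComputeI_sorted a b :
  (forall a' b', (\sum_j b' j < \sum_j b j)%N \/
     (\sum_j b' j = \sum_j b j /\ free_degree a' b' < free_degree a b)%N ->
     correct a' b') ->
  valid a b -> (b i0 <= b i1 <= b i2)%N ->
  returns (ComputeI_sorted (\sum_j a j) a b) (M a b) /\ M a b \is a fin_num.
Proof.
move=> IH v /andP[b01 b12]; rewrite /ComputeI_sorted.
have v0 := v i0; have v1 := v i1; have v2 := v i2.
case: ifPn => [/andP[/eqP b0 /eqP b1]|nb].
  rewrite moment_fact //; last by rewrite sumn_I3 in v2; lia.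
  split => //.
  set x := (\sum_j _ j + _ - _)`!%:R; set y := (_ + _ + 1)`!%:R.
  have x0 : x != 0 :> R by rewrite pnatr_eq0 -lt0n fact_gt0.
  have y0 : y != 0 :> R by rewrite pnatr_eq0 -lt0n fact_gt0.
  rewrite (_ : 2 * (_ / (y * x)) = 2 * (((a i0)`! * (a i1)`! * (a i2)`!)%:R / x) *
    ((a i0 + a i1 + 1 - b i2)`!%:R / y)); first exact: returns_Ret.
  rewrite (natrM _ (_ * _)%N) natrM.
  by rewrite -[RHS]mulrA mulf_div [x * y]mulrC.
case: ifPn => [b0|].
  (* All entries of [b] are positive, the smallest being at [i0]. Hence [b] is [B] raised at the
     three places, and each call is on [B] raised at two of them, as in [moment_corners]. *)
  pose B := b :- i0 :- i1 :- i2.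
  have eb0 : b :- i0 = B :+ i1 :+ i2 by apply/ffunP; apply: I3P;
    rewrite !ffunE /=; lia.
  have eb1 : b :- i1 = B :+ i0 :+ i2 by apply/ffunP; apply: I3P;
    rewrite !ffunE /=; lia.
  have eb2 : b :- i2 = B :+ i0 :+ i1 by apply/ffunP; apply: I3P;
    rewrite !ffunE /=; lia.
  have eb : b = B :+ i0 :+ i1 :+ i2 by apply/ffunP; apply: I3P;
    rewrite !ffunE /=; lia.
  have vs j : valid a (b :- j) by move=> i; rewrite ffunE; have := v i; lia.
  have [r0 /(_ (vs i0)) f0] : correct a (b :- i0).
    by apply: IH; left; rewrite !sumn_I3 !ffunE /=; lia.
  have [r1 /(_ (vs i1)) f1] : correct a (b :- i1).
    by apply: IH; left; rewrite !sumn_I3 !ffunE /=; lia.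
  have [r2 /(_ (vs i2)) f2] : correct a (b :- i2).
    by apply: IH; left; rewrite !sumn_I3 !ffunE /=; lia.
  have := moment_corners R a B; rewrite -eb -eb0 -eb1 -eb2 => e.
  have fM : M a b \is a fin_num.
    have : (M a b + M a b)%E \is a fin_num by rewrite -e !fin_numD f0 f1 f2.
    by rewrite fin_numD => /andP[].
  split => //; apply: returns_CallI r0 _; apply: returns_CallI r1 _.
  by apply: returns_CallI r2 _; rewrite e half_double //; exact: returns_Ret.
rewrite -eqn0Ngt => /eqP b0; move: nb; rewrite b0 /= => b1.
have {}b1 : (0 < b i1)%N by rewrite lt0n.
have fd : free_degree a b = a i0.
  by rewrite /free_degree sumn_I3 b0 /= !ifN ?addn0 -?lt0n //; lia.
case: ifPn => [/eqP a0|a0].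
  have [rJ fJ] := returns_ComputeJ R (a i1) (a i2) (b i1) (b i2).
  have <- : edge_moment R (a i1) (a i2) (b i1) (b i2) = M a b.
    rewrite /edge_moment; congr (M _ _).
    - by rewrite -[RHS]triple_eta a0.
    - by rewrite -[RHS]triple_eta b0.
  split; first by apply: returns_CallJ rJ _; exact: returns_Ret.
  by apply: fJ; rewrite sumn_I3 in v1 v2; apply/andP; split; lia.
pose A := a :- i0.
have ea : a = A :+ i0 by rewrite subhatK ?lt0n.
have sA : (\sum_j a j = (\sum_j A j).+1)%N by rewrite {1}ea sum_addhat.
have lt1 a' (k : 'I_3) : (0 < b k)%N -> (valid a' (b :- k) -> M a' (b :- k) \is
  a fin_num) /\
    returns (ComputeI R a' (b :- k)) (M a' (b :- k)).
  move=> bk; have [] : correct a' (b :- k); last by split.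
  by apply: IH; left; rewrite -[in ltnRHS](subhatK bk) sum_addhat.
have b2 : (0 < b i2)%N by lia.
rewrite -/A; rewrite !sumn_I3 in v0 v1 v2.
have free_lt a' : (a' i0 < a i0)%N -> correct a' b.
  move=> h; apply: IH; right; split => //.
  by rewrite fd /free_degree sumn_I3 b0 /= !ifN ?addn0 -?lt0n.
have moment_side' (j k : 'I_3) : j != i0 -> j != k -> k != i0 -> (0 < b k)%N ->
    M A (b :- k) = (M a b + M (A :+ j) b)%E.
  by rewrite eq_sym => j0 jk k0 bk; rewrite (moment_side R A (b :- k) j0 jk k0)
    -ea subhatK.
(* The two difference branches at once, with (j, k) = (1, 2) or (2, 1). The strict inequality at [j]
   keeps both calls valid: one has smaller total degree in the numerator, the other a raised entry
   at [j]. *)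
have side (j k : 'I_3) : j != i0 -> j != k -> k != i0 -> (a j + b j < \sum_i a i
  + 1)%N ->
  returns (CallI A (b :- k) (fun r => CallI (A :+ j) b (fun r' =>
    Ret (r - r')%E))) (M a b) /\
  M a b \is a fin_num.
  move=> j0 jk k0 hj; rewrite sumn_I3 in hj.
  have bk : (0 < b k)%N by move: k k0 {jk}; apply: I3P.
  have vA : valid A (b :- k).
    move: j k j0 jk k0 hj {bk}; do 2 apply: I3P => //;
      move=> _ _ _ hj; apply: I3P; rewrite !sumn_I3 !ffunE /=; lia.
  have vA' : valid (A :+ j) b.
    move: j k j0 jk k0 hj {bk vA}; do 2 apply: I3P => //;
      move=> _ _ _ hj; apply: I3P; rewrite !sumn_I3 !ffunE /=; lia.
  have [fr rr] := lt1 A k bk; have {}fr := fr vA.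
  have [|rr' fr'] := free_lt (A :+ j).
    by rewrite !ffunE eq_sym (negbTE j0) /=; lia.
  have {}fr' := fr' vA'.
  have [fM eM] := sub_of_add fr fr' (moment_side' j k j0 jk k0 bk).
  split => //; apply: returns_CallI rr _; apply: returns_CallI rr' _.
  by rewrite eM; exact: returns_Ret.
case: ifPn => [h1|n1]; first exact: side.
case: ifPn => [h2|n2]; first exact: side.
(* Now a_j + b_j = |a| + 1 for j = 1, 2. The two sums that the algorithm averages are equal: each is
   the moment of [A] and [b :- i1 :- i2], from which [moment_two_sides] yields the result. *)
have half (j k : 'I_3) : j != i0 -> j != k -> k != i0 ->
  M A (b :- i1 :- i2) = (M a (b :- j) + M (A :+ j) (b :- j))%E.
  move=> j0 jk k0; have := j0; rewrite eq_sym => j0'.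
  rewrite (moment_side R A (b :- i1 :- i2) j0' jk k0).
  rewrite -ea; congr (M _ _ + M _ _)%E;
    move: j k j0 jk k0 {j0'}; do 2 apply: I3P => //; move=> _ _ _; apply/ffunP;
      apply: I3P; rewrite !ffunE /=; lia.
have v8 : valid (A :+ i1 :+ i2) b.
  by apply: I3P; rewrite !sumn_I3 !ffunE /=; lia.
have v8' j : j != i0 -> valid (A :+ j) (b :- j).
  by move: j; apply: I3P => // _; apply: I3P; rewrite !sumn_I3 !ffunE /=; lia.
have v8'' j : valid a (b :- j) by move=> i; rewrite ffunE; have := v i; lia.
have [fr1 rr1] := lt1 a i1 b1; have {}fr1 := fr1 (v8'' _).
have [fr1' rr1'] := lt1 (A :+ i1) i1 b1; have {}fr1' := fr1' (v8' i1 isT).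
have [fr2 rr2] := lt1 a i2 b2; have {}fr2 := fr2 (v8'' _).
have [fr2' rr2'] := lt1 (A :+ i2) i2 b2; have {}fr2' := fr2' (v8' i2 isT).
have [|rr fr] := free_lt (A :+ i1 :+ i2); first by rewrite !ffunE /=; lia.
have {}fr := fr v8.
have fA : M A (b :- i1 :- i2) \is a fin_num.
  by rewrite (half i1 i2) // fin_numD fr1 fr1'.
have eA : M A (b :- i1 :- i2) = (M a b + M (A :+ i1 :+ i2) b)%E.
  rewrite moment_two_sides -ea.
  have -> // : b :- i1 :- i2 :+ i1 :+ i2 = b.
  by apply/ffunP; apply: I3P; rewrite !ffunE /=; lia.
have [fM eM] := sub_of_add fA fr eA.
split => //; apply: returns_CallI rr1 _; apply: returns_CallI rr1' _.
apply: returns_CallI rr2 _; apply: returns_CallI rr2' _; apply: returns_CallI rr _.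
rewrite -(half i1 i2) // -(half i2 i1) // half_double // eM; exact: returns_Ret.
Qed.

Let sorted_triple (t : 3.-tuple (nat * nat)) :
  sorted (fun p q => (p.2 <= q.2)%N) t ->
  ((tnth t i0).2 <= (tnth t i1).2 <= (tnth t i2).2)%N.
Proof.
by rewrite !(tnth_nth (0, 0)%N); case: t => [[|x [|y [|z [|//]]]] h] //=;
  rewrite andbT.
Qed.

Lemma returns_ComputeI a b : correct a b.
Proof.
have [N] := ubnP (\sum_j b j)%N; elim: N a b => // N IHN a b bN.
have [m] := ubnP (free_degree a b); elim: m a b bN => // m IHm a b bN fm.
have IH a' b' : (\sum_j b' j < \sum_j b j)%N \/
    (\sum_j b' j = \sum_j b j /\ free_degree a' b' < free_degree a b)%N ->
      correct a' b'.
  case=> [h|[e h]]; first by apply: IHN; exact: leq_trans h bN.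
  by apply: IHm; [rewrite e|exact: leq_trans h fm].
rewrite /correct /ComputeI; case: ifPn => [|].
  have [|j ej] := @bigop.eq_bigmax _ (fun j => a j + b j)%N;
    first by rewrite card_ord.
  rewrite ej => inv; rewrite (moment_pinfty R inv); split; first exact: returns_Ret.
  by move=> /(_ j); rewrite leqNgt inv.
rewrite -leqNgt => /bigop.bigmax_leqP h; have v : valid a b by move=> j; exact: h.
(* Any admissible result of the sort is the input read through a permutation, which preserves the
   moment, the degrees and the termination measure. *)
have key (t : 3.-tuple (nat * nat)) : perm_eq t [tuple (a j, b j) | j < 3] ->
    sorted (fun p q => (p.2 <= q.2)%N) t ->
    returns (ComputeI_sorted (\sum_j a j) [ffun j => (tnth t j).1] [ffun j =>
      (tnth t j).2]) (M a b) /\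
    M a b \is a fin_num.
  move=> /tuple_permP[p tE] /sorted_triple.
  have {}tE : t = [tuple tnth [tuple (a j, b j) | j < 3] (p i) | i < 3] by
    exact/val_inj.
  pose a' : {ffun 'I_3 -> nat} := [ffun j => a (p j)].
  pose b' : {ffun 'I_3 -> nat} := [ffun j => b (p j)].
  have ta : [ffun j => (tnth t j).1] = a'.
    by apply/ffunP => j; rewrite !ffunE tE !tnth_mktuple.
  have tb : [ffun j => (tnth t j).2] = b'.
    by apply/ffunP => j; rewrite !ffunE tE !tnth_mktuple.
  have -> : (tnth t i0).2 = b' i0 by rewrite -tb ffunE.
  have -> : (tnth t i1).2 = b' i1 by rewrite -tb ffunE.
  have -> : (tnth t i2).2 = b' i2 by rewrite -tb ffunE.
  rewrite ta tb -(moment_perm R p) -/a' -/b'.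
  have sa : (\sum_j a j = \sum_j a' j)%N.
    by rewrite (reindex_inj (@perm_inj _ p)); apply: eq_bigr => j _; rewrite ffunE.
  have sb : (\sum_j b j = \sum_j b' j)%N.
    by rewrite (reindex_inj (@perm_inj _ p)); apply: eq_bigr => j _; rewrite ffunE.
  have fab : free_degree a b = free_degree a' b'.
    rewrite /free_degree (reindex_inj (@perm_inj _ p)).
    by apply: eq_bigr => j _; rewrite !ffunE.
  rewrite sa; apply: returns_ComputeI_sorted.
    by move=> a1 b1; rewrite -sb -fab; exact: IH.
  by move=> j; rewrite -sa !ffunE; exact: v.
split.
  by apply: returns_Sort => t pt st; exact: (key t pt st).1.
move=> _; have leT : total (fun p q : nat * nat =>
  (p.2 <= q.2)%N) by move=> p q; exact: leq_total.
(* Finiteness does not depend on the order, but [key] yields it only for a sorted tuple, so one is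
   exhibited. *)
have [] // := key (sort_tuple (fun p q : nat * nat =>
  (p.2 <= q.2)%N) [tuple (a j, b j) | j < 3]).
- by rewrite perm_sort.
- exact: sort_sorted.
Qed.

End ComputeICorrect.

Theorem theorem3p10 (R : realType) (v : 'I_3 -> R * R)
    (lam : 'I_3 -> R * R -> R) (alpha beta : {ffun 'I_3 -> nat})
    (hv : noncollinear v) (hlam : barycentric v lam) :
  returns (ComputeI R alpha beta) (Ival v lam alpha beta) /\
  (0 <= Ival v lam alpha beta)%E.
Proof.
rewrite (Ival_moment hv hlam); split; last exact: moment_ge0.
by have [] := returns_ComputeI R alpha beta.
Qed.
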